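(* Let $W$ be a right-angled Coxeter group (of a finite simplicial graph $\Gamma$). If the outer automorphism group $\operatorname{Aut}W/\operatorname{Inn}W$ is infinite, then $W$ has property (NLC); that is, for every CAT(0) space $X$ on which $W$ acts geometrically, the visual boundary $\partial X$ is not locally connected.
   Context: $\Gamma$ is a finite simplicial graph with non-empty vertex set $V=\{v_1,\dots,v_N\}$. The right-angled Coxeter group $W$ of $\Gamma$ is the group with generators $V$ and relations $v_i^2=1$ for all $i$ and $v_jv_k=v_kv_j$ whenever $v_j,v_k$ are adjacent in $\Gamma$. A geometric action is a properly discontinuous, cocompact action by isometries. *)

(* Defs.v *)
From HB Require Import structures.
From mathcomp Require Import all_boot all_order all_algebra.
From mathcomp Require Import all_classical all_reals all_analysis.

Set Implicit Arguments.
Unset Strict Implicit.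
Unset Printing Implicit Defensive.

Import Order.TTheory GRing.Theory Num.Theory.

Local Open Scope classical_set_scope.
Local Open Scope ring_scope.
Local Open Scope quotient_scope.

(** * Right-angled Coxeter groups *)

(* The congruence on words generated by the defining relations. Since every
   generator is its own inverse, words in the generators alone (without formal
   inverses) suffice; [racg_universal] below is the universal property of the
   group presentation. *)
Inductive racg_eq (V : finType) (e : rel V) : seq V -> seq V -> Prop :=
| racg_eq_refl w : racg_eq e w w
| racg_eq_sym w1 w2 : racg_eq e w1 w2 -> racg_eq e w2 w1
| racg_eq_trans w1 w2 w3 :
    racg_eq e w1 w2 -> racg_eq e w2 w3 -> racg_eq e w1 w3
| racg_eq_square s t v : racg_eq e (s ++ [:: v; v] ++ t) (s ++ t)
| racg_eq_comm s t v w :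
    e v w -> racg_eq e (s ++ [:: v; w] ++ t) (s ++ [:: w; v] ++ t).

Section RACG.
Variables (V : finType) (e : rel V).

Definition racg_eqb : rel (seq V) := fun w1 w2 => `[< racg_eq e w1 w2 >].

Lemma racg_eqb_refl : reflexive racg_eqb.
Proof. by move=> w; apply/asboolP/racg_eq_refl. Qed.

Lemma racg_eqb_sym : symmetric racg_eqb.
Proof.
by move=> w1 w2; apply/idP/idP => /asboolP h; apply/asboolP/racg_eq_sym.
Qed.

Lemma racg_eqb_trans : transitive racg_eqb.
Proof.
move=> w2 w1 w3 /asboolP h1 /asboolP h2.
by apply/asboolP; apply: racg_eq_trans h1 h2.
Qed.

Canonical racg_equiv :=
  EquivRel racg_eqb racg_eqb_refl racg_eqb_sym racg_eqb_trans.

Definition racg : Type := {eq_quot racg_equiv}.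
HB.instance Definition _ := Choice.on racg.
HB.instance Definition _ := EqQuotient.on racg.

Lemma racg_pi_eq (w1 w2 : seq V) :
  \pi_racg w1 = \pi_racg w2 <-> racg_eq e w1 w2.
Proof.
by split=> [/eqmodP/asboolP // | h]; apply/eqmodP/asboolP.
Qed.

Lemma racg_eq_catl u w1 w2 : racg_eq e w1 w2 -> racg_eq e (u ++ w1) (u ++ w2).
Proof.
elim=> {w1 w2} [w|w1 w2 _|w1 w2 w3 _ h1 _ h2|s t v|s t v w vw].
- exact: racg_eq_refl.
- exact: racg_eq_sym.
- exact: racg_eq_trans h1 h2.
- by rewrite !(catA u); apply: racg_eq_square.
- by rewrite !(catA u); apply: racg_eq_comm.
Qed.

Lemma racg_eq_catr u w1 w2 : racg_eq e w1 w2 -> racg_eq e (w1 ++ u) (w2 ++ u).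
Proof.
elim=> {w1 w2} [w|w1 w2 _|w1 w2 w3 _ h1 _ h2|s t v|s t v w vw].
- exact: racg_eq_refl.
- exact: racg_eq_sym.
- exact: racg_eq_trans h1 h2.
- by rewrite -!catA; apply: racg_eq_square.
- by rewrite -!catA; apply: racg_eq_comm.
Qed.

Lemma racg_eq_rev w1 w2 : racg_eq e w1 w2 -> racg_eq e (rev w1) (rev w2).
Proof.
elim=> {w1 w2} [w|w1 w2 _|w1 w2 w3 _ h1 _ h2|s t v|s t v w vw].
- exact: racg_eq_refl.
- exact: racg_eq_sym.
- exact: racg_eq_trans h1 h2.
- by rewrite !rev_cat -!catA; apply: racg_eq_square.
- by rewrite !rev_cat -!catA; apply/racg_eq_sym/racg_eq_comm.
Qed.

Lemma racg_eq_revl w : racg_eq e (rev w ++ w) [::].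
Proof.
elim: w => [|v w IHw]; first exact: racg_eq_refl.
rewrite rev_cons -cats1 -catA.
apply: racg_eq_trans IHw.
exact: (racg_eq_square e (rev w) w v).
Qed.

Definition racg_mul (x y : racg) : racg := \pi_racg (repr x ++ repr y).
Definition racg_one : racg := \pi_racg [::].
Definition racg_inv (x : racg) : racg := \pi_racg (rev (repr x)).

Lemma racg_repr_pi w : racg_eq e (repr (\pi_racg w)) w.
Proof. by apply/racg_pi_eq; rewrite reprK. Qed.

Lemma racg_mul_pi w1 w2 :
  racg_mul (\pi_racg w1) (\pi_racg w2) = \pi_racg (w1 ++ w2).
Proof.
apply/racg_pi_eq; apply: racg_eq_trans (racg_eq_catr _ (racg_repr_pi w1)) _.
exact: racg_eq_catl (racg_repr_pi w2).
Qed.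

Lemma racg_inv_pi w : racg_inv (\pi_racg w) = \pi_racg (rev w).
Proof. exact/racg_pi_eq/racg_eq_rev/racg_repr_pi. Qed.

Lemma racg_mulA : associative racg_mul.
Proof.
elim/quotW=> x; elim/quotW=> y; elim/quotW=> z.
rewrite [racg_mul (\pi y) _]racg_mul_pi [racg_mul (\pi x) (\pi y)]racg_mul_pi.
by rewrite [LHS]racg_mul_pi [RHS]racg_mul_pi catA.
Qed.

Lemma racg_mul1 : left_id racg_one racg_mul.
Proof. by move=> x; rewrite -(reprK x) racg_mul_pi. Qed.

Lemma racg_mulr1 : right_id racg_one racg_mul.
Proof. by move=> x; rewrite -(reprK x) racg_mul_pi cats0. Qed.

Lemma racg_mulV : left_inverse racg_one racg_inv racg_mul.
Proof.
move=> x; rewrite -(reprK x) racg_inv_pi racg_mul_pi.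
exact/racg_pi_eq/racg_eq_revl.
Qed.

Lemma racg_mulrV : right_inverse racg_one racg_inv racg_mul.
Proof.
move=> x; rewrite -(reprK x) racg_inv_pi racg_mul_pi.
apply/racg_pi_eq; rewrite -{1}(revK (repr x)); exact: racg_eq_revl.
Qed.

HB.instance Definition _ := isGroup.Build racg
  racg_mulA racg_mul1 racg_mulr1 racg_mulV racg_mulrV.

Definition racg_gen (v : V) : racg := \pi_racg [:: v].

Local Open Scope group_scope.

Lemma racg_gen_square v : racg_gen v * racg_gen v = 1.
Proof.
by rewrite [LHS]racg_mul_pi; apply/racg_pi_eq/(racg_eq_square e [::] [::] v).
Qed.

Lemma racg_gen_comm v w :
  e v w -> racg_gen v * racg_gen w = racg_gen w * racg_gen v.
Proof.
move=> vw; rewrite [LHS]racg_mul_pi [RHS]racg_mul_pi; apply/racg_pi_eq.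
exact: (racg_eq_comm [::] [::] vw).
Qed.

Lemma racg_universal (H : groupType) (f : V -> H) :
    (forall v, f v * f v = 1) ->
    (forall v w, e v w -> f v * f w = f w * f v) ->
  exists! F : racg -> H,
    {morph F : x y / x * y} /\ (forall v, F (racg_gen v) = f v).
Proof.
move=> f2 fC; pose ev (w : seq V) := \prod_(v <- w) f v.
have ev_eq w1 w2 : racg_eq e w1 w2 -> ev w1 = ev w2.
  elim=> {w1 w2} [//|w1 w2 _ -> //|w1 w2 w3 _ -> _ -> //|s t v|s t v w vw].
    by rewrite /ev !big_cat /= !big_cons big_nil mulg1 f2 mul1g.
  by rewrite /ev !big_cat /= !big_cons big_nil !mulg1 fC.
have evM w1 w2 : ev (w1 ++ w2) = ev w1 * ev w2 by exact: big_cat.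
exists (fun x => ev (repr x)); split=> [|F [Fm Fv]].
  split=> [x y|v]; first by rewrite -evM; exact/ev_eq/racg_repr_pi.
  by rewrite (ev_eq _ [:: v] (racg_repr_pi _)) /ev big_seq1.
have F1 : F 1 = 1 by apply: (@mulgI _ (F 1)); rewrite mulg1 -Fm mulg1.
apply/funext => x; rewrite -[in RHS](reprK x); elim: (repr x) => [|v w IHw].
  by rewrite /ev big_nil -F1.
rewrite /ev big_cons -/(ev w) IHw -Fv -Fm; congr F.
exact: racg_mul_pi.
Qed.

End RACG.

(** * Outer automorphisms *)

Section Outer.
Variable G : groupType.
Local Open Scope group_scope.

Definition Aut : set (G -> G) :=
  [set f | bijective f /\ {morph f : x y / x * y}].

Definition Inn : set (G -> G) := [set (fun x => g * x * g^-1) | g in [set: G]].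

(* The underlying set of the quotient group Aut G / Inn G: the cosets of
   Inn G in Aut G. *)
Definition Out : set (set (G -> G)) :=
  [set [set f \o i | i in Inn] | f in Aut].

End Outer.

Arguments Aut G : clear implicits.
Arguments Inn G : clear implicits.
Arguments Out G : clear implicits.

(** * CAT(0) spaces *)

Section Euclidean.
Variable R : realType.

Definition edist (x y : R * R) : R :=
  Num.sqrt ((x.1 - y.1) ^+ 2 + (x.2 - y.2) ^+ 2).

Definition esegment (x y : R * R) : set (R * R) :=
  [set ((1 - t) * x.1 + t * y.1, (1 - t) * x.2 + t * y.2) | t in `[0, 1]].

End Euclidean.

Section CAT0.
Variables (R : realType) (X : metricType R).

Definition geodesic (c : R -> X) (x y : X) : Prop :=
  [/\ c 0 = x, c (mdist x y) = y &
      forall s t, s \in `[0, mdist x y] -> t \in `[0, mdist x y] ->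
        mdist (c s) (c t) = `|s - t|].

Definition geodesic_segment (S : set X) (x y : X) : Prop :=
  exists2 c, geodesic c x y & S = c @` `[0, mdist x y].

Definition geodesic_space : Prop :=
  forall x y : X, exists c, geodesic c x y.

(* p' is a comparison point in [x', y'] for the point p of the side S = [x, y] *)
Definition comparison_on_side (S : set X) (x y : X) (x' y' : R * R)
    (p : X) (p' : R * R) : Prop :=
  [/\ S p, esegment x' y' p' & edist x' p' = mdist x p].

Definition CAT0 : Prop :=
  geodesic_space /\
  forall (x y z : X) (S1 S2 S3 : set X) (x' y' z' : R * R),
    geodesic_segment S1 x y -> geodesic_segment S2 y z ->
    geodesic_segment S3 z x ->
    edist x' y' = mdist x y -> edist y' z' = mdist y z ->
    edist z' x' = mdist z x ->
    let comparison p p' :=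
      [\/ comparison_on_side S1 x y x' y' p p',
          comparison_on_side S2 y z y' z' p p' |
          comparison_on_side S3 z x z' x' p p'] in
    forall p q p' q', comparison p p' -> comparison q q' ->
      mdist p q <= edist p' q'.

End CAT0.

(** * Geometric actions *)

Record geometric_action (R : realType) (G : groupType) (X : metricType R)
    (act : G -> X -> X) : Prop := {
  act1 : forall x, act 1%g x = x;
  actM : forall g h x, act (g * h)%g x = act g (act h x);
  act_isometry : forall g x y, mdist (act g x) (act g y) = mdist x y;
  act_properly_discontinuous : forall K : set X, compact K ->
    finite_set [set g | (act g @` K) `&` K !=set0];
  act_cocompact :
    exists2 K : set X, compact K & \bigcup_(g in [set: G]) (act g @` K) = setT
}.

(** * The visual boundary *)

Section Boundary.
Variables (R : realType) (X : metricType R).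

(* Values at negative times are irrelevant: rays that differ only there are
   asymptotic. *)
Record geodesic_ray := GeodesicRay {
  ray_fun :> R -> X;
  ray_isometric : forall s t, 0 <= s -> 0 <= t ->
    mdist (ray_fun s) (ray_fun t) = `|s - t|
}.

HB.instance Definition _ := gen_eqMixin geodesic_ray.
HB.instance Definition _ := gen_choiceMixin geodesic_ray.

Definition asymptotic (c c' : geodesic_ray) : Prop :=
  exists K : R, forall t, 0 <= t -> mdist (c t) (c' t) <= K.

Definition asymptoticb : rel geodesic_ray := fun c c' => `[< asymptotic c c' >].

Lemma asymptoticb_refl : reflexive asymptoticb.
Proof. by move=> c; apply/asboolP; exists 0 => t _; rewrite mdistxx. Qed.

Lemma asymptoticb_sym : symmetric asymptoticb.
Proof.
by move=> c c'; apply/idP/idP => /asboolP[K h]; apply/asboolP; exists K => t t0;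
  rewrite metric_sym h.
Qed.

Lemma asymptoticb_trans : transitive asymptoticb.
Proof.
move=> c2 c1 c3 /asboolP[K h] /asboolP[L k]; apply/asboolP; exists (K + L).
by move=> t t0; rewrite (le_trans (metric_triangle _ (c2 t) _))// lerD ?h ?k.
Qed.

Canonical asymptotic_equiv :=
  EquivRel asymptoticb asymptoticb_refl asymptoticb_sym asymptoticb_trans.

Definition boundary : Type := {eq_quot asymptotic_equiv}.
HB.instance Definition _ := Choice.on boundary.
HB.instance Definition _ := EqQuotient.on boundary.

(* The points of the boundary represented by a ray issuing from x0 whose
   position at time r is at distance less than eps from that of c. *)
Definition cone_nbhd (x0 : X) (c : geodesic_ray) (r eps : R) : set boundary :=
  [set \pi_boundary c' | c' in
    [set c' : geodesic_ray | c' 0 = x0 /\ mdist (c r) (c' r) < eps]].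

Definition cone_subbase (x0 : X) : set (set boundary) :=
  [set U | exists (c : geodesic_ray) (r eps : R),
    [/\ c 0 = x0, 0 < r, 0 < eps & U = cone_nbhd x0 c r eps]].

(* The boundary with the cone topology based at x0. On a complete CAT(0) space
   this topology does not depend on x0, and the sets above form a base. *)
Definition visual_boundary (x0 : X) : Type := boundary.
HB.instance Definition _ (x0 : X) := Choice.on (visual_boundary x0).
HB.instance Definition _ (x0 : X) :=
  @isSubBaseTopological.Build (visual_boundary x0) (set boundary)
    (cone_subbase x0) id.

Lemma cone_nbhd_open (x0 : X) (c : geodesic_ray) (r eps : R) :
  c 0 = x0 -> 0 < r -> 0 < eps ->
  open (cone_nbhd x0 c r eps : set (visual_boundary x0)).
Proof.
move=> c0 r0 eps0; set U := cone_nbhd x0 c r eps.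
have subU : cone_subbase x0 U by exists c, r, eps.
exists [set U]; last by rewrite bigcup_set1.
by move=> _ ->; exact: (finI_from1 id subU).
Qed.

End Boundary.

(** * Property (NLC) *)

Definition locally_connected (T : topologicalType) : Prop :=
  forall (x : T) (U : set T), nbhs x U ->
    exists V : set T, [/\ open V, connected V, V x & V `<=` U].

(* Quantifying over all base points x0 also excludes the empty space X. *)
Definition NLC (R : realType) (G : groupType) : Prop :=
  forall (X : metricType R) (act : G -> X -> X),
    CAT0 X -> geometric_action act ->
    forall x0 : X, ~ locally_connected (visual_boundary x0).

(* Main.v *)
(* If Out W is infinite then the graph has a separating intersection of links
   (SIL): non-adjacent v, w and a union K of components of the complement of
   L = Lk v & Lk w that contains neither v nor w.

   Without a SIL, Out W is finite.  W acts geometrically on a CAT(0) space, so it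
   has finitely many conjugacy classes of involutions and it suffices to treat the
   automorphisms f sending each generator to a conjugate.  Such an f is recorded by
   the walls of the reflections f v.  If for each v all the walls disjoint from that
   of f v are on the same side of it, these walls bound a single chamber and f is
   inner.  In general one partial conjugation per vertex achieves this, the absence
   of a SIL ensuring that it does not spoil the other vertices.

   With a SIL, W splits over the special subgroup C of L, which commutes with
   t = v w.  Let u be in K and let H be the half of W containing the positive powers
   of u v, cut off by C.  The rays issuing from x0 towards t ^ m (u v) ^ oo accumulate
   at a boundary point at which a Busemann function of the repelling end of t tends
   to infinity linearly.  This function is invariant under C, so near that point the
   limit set of each t ^ m H is open and closed; no small neighbourhood of the point
   is connected. *)
From HB Require Import structures.
From mathcomp Require Import all_boot all_order all_algebra.
From mathcomp Require Import all_classical all_reals all_analysis.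
From mathcomp Require Import zify lra.
Require Import Defs.

Set Implicit Arguments.
Unset Strict Implicit.
Unset Printing Implicit Defensive.

Import Order.TTheory GRing.Theory Num.Theory.
Import numFieldNormedType.Exports.

Local Open Scope classical_set_scope.

(** Walls live in W, not in X: nesting of half-spaces is derived from the cocycle [sep]. In X the
    fixed set of a reflection need not separate anything, so a half of W is seen in X only coarsely,
    through the orbit of x0: points a bounded distance apart that belong to different halves are
    uniformly close to a translate of C. The difficulty in the SIL case is to keep a definite escape
    rate in the limit of the rays, which needs a lower bound. The involutions t ^ n v and v t ^ n
    compose to t ^ (2 n), so for n a power of 2 their displacements add up to at least 2 n times the
    translation length of t. Hence an upper bound for the first, easy to get on t ^ m C, is a lower
    bound for the second. The ray of index m comes near t ^ m C in time at most linear in m, and the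
    first displacement has dropped there by an amount linear in m. Convexity then yields, at one
    fixed time r, a bound independent of m. *)

Lemma ex_min_nat (T : Type) (P : T -> Prop) (m : T -> nat) :
  (exists x, P x) -> exists2 x, P x & forall y, P y -> (m x <= m y)%N.
Proof.
move=> [x0 Px0].
have exn : exists n, `[< exists2 x, P x & m x = n >].
  by exists (m x0); apply/asboolP; exists x0.
case: (ex_minnP exn) => n /asboolP[x Px mx] min_n; exists x => // y Py.
by rewrite mx; apply: min_n; apply/asboolP; exists y.
Qed.

Section Conjugation.
Local Open Scope group_scope.

Lemma commute_conj (G : groupType) (x y : G) : commute x y -> x ^ y = x.
Proof. by move=> xy; apply/conjg_fixP/commgP. Qed.

Lemma conjg_eq (G : groupType) (x y z : G) : (x ^ z == y ^ z) = (x == y).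
Proof. exact: inj_eq (@conjg_inj G z) x y. Qed.

Lemma conj_commute (G : groupType) (x y : G) : x ^ y = x -> commute x y.
Proof. by move/conjg_fixP/commgP. Qed.

Lemma commuteJ (G : groupType) (x y z : G) : commute x y -> commute (x ^ z) (y ^ z).
Proof. by rewrite /commute -!conjMg => ->. Qed.

Lemma commuteJE (G : groupType) (x y z : G) : commute (x ^ z) (y ^ z) <-> commute x y.
Proof.
split=> [h|]; last exact: commuteJ.
by rewrite -(conjgK z x) -(conjgK z y); exact: commuteJ.
Qed.

End Conjugation.

(** * Words, length and walls *)

Section Words.
Local Open Scope group_scope.
Variables (V : finType) (e : rel V).
Local Notation W := (racg e).
Local Notation gen := (racg_gen e).
Implicit Types (v a b z : V) (w : seq V) (g h r q : W).

Definition word w : W := \pi_(racg e)%qT w.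

Lemma word_nil : word [::] = 1. Proof. by []. Qed.

Lemma word_cat w1 w2 : word (w1 ++ w2) = word w1 * word w2.
Proof. by rewrite /word -racg_mul_pi. Qed.

Lemma word_cons v w : word (v :: w) = gen v * word w.
Proof. exact: (word_cat [:: v] w). Qed.

Lemma word_rcons w v : word (rcons w v) = word w * gen v.
Proof. by rewrite -cats1 word_cat. Qed.

Lemma word_repr g : word (repr g) = g.
Proof. exact: reprK. Qed.

Lemma word_rev w : word (rev w) = (word w)^-1.
Proof. by rewrite /word -racg_inv_pi. Qed.

Lemma genV v : (gen v)^-1 = gen v.
Proof. exact/mulg1_eq/racg_gen_square. Qed.

Lemma genK v : involutive (fun g => gen v * g).
Proof. by move=> g; rewrite mulgA racg_gen_square mul1g. Qed.

Lemma word_ind (P : W -> Prop) :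
  P 1 -> (forall v g, P g -> P (gen v * g)) -> forall g, P g.
Proof.
move=> P1 PM g; rewrite -(word_repr g).
by elim: (repr g) => [|v w IHw] //; rewrite word_cons; exact: PM.
Qed.

(** * Actions of the group by involutions *)

Section Action.
Variables (T : Type) (f : V -> T -> T).
Hypothesis f2 : forall v x, f v (f v x) = x.
Hypothesis fC : forall v z x, e v z -> f v (f z x) = f z (f v x).

Definition word_act w x := foldr f x w.

Lemma word_act_eq w1 w2 x : racg_eq e w1 w2 -> word_act w1 x = word_act w2 x.
Proof.
move=> h; elim: h x => {w1 w2}
  [//|w1 w2 _ IH x|w1 w2 w3 _ h1 _ h2 x|s t v x|s t v w vw x].
- by rewrite IH.
- by rewrite h1 h2.
- by rewrite /word_act !foldr_cat /= f2.
- by rewrite /word_act !foldr_cat /= fC.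
Qed.

Definition racg_act g x := word_act (repr g) x.

Lemma racg_act_word w x : racg_act (word w) x = word_act w x.
Proof. exact/word_act_eq/racg_repr_pi. Qed.

Lemma racg_actM g h x : racg_act (g * h) x = racg_act g (racg_act h x).
Proof.
rewrite -{1}(word_repr g) -{1}(word_repr h) -word_cat racg_act_word.
by rewrite /word_act foldr_cat.
Qed.

Lemma racg_act_gen v x : racg_act (gen v) x = f v x.
Proof. exact: (racg_act_word [:: v]). Qed.

Lemma racg_act1 x : racg_act 1 x = x.
Proof. exact: (racg_act_word [::]). Qed.

End Action.

Definition parity_act a v (p : bool) := if v == a then ~~ p else p.

(** The homomorphism to Z/2 that kills every generator but a. It tells the conjugacy classes of
    generators apart, so that the type of a wall is well defined. *)
Definition parity a g : bool := racg_act (parity_act a) g false.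

Lemma parity_act2 a v p : parity_act a v (parity_act a v p) = p.
Proof. by rewrite /parity_act; case: eqP => // _; rewrite negbK. Qed.

Lemma parity_actC a v z p : e v z ->
  parity_act a v (parity_act a z p) = parity_act a z (parity_act a v p).
Proof. by rewrite /parity_act; case: eqP; case: eqP. Qed.

Lemma parity_actE a g p : racg_act (parity_act a) g p = parity a g (+) p.
Proof.
rewrite /parity /racg_act; elim: (repr g) => [|v w IHw] //=.
by rewrite IHw /parity_act; case: eqP => // _; rewrite addNb.
Qed.

Lemma parityM a g h : parity a (g * h) = parity a g (+) parity a h.
Proof.
by rewrite {1}/parity (racg_actM (@parity_act2 a) (@parity_actC a)) parity_actE.
Qed.

Lemma parity_gen a v : parity a (gen v) = (v == a).
Proof.
rewrite /parity (racg_act_gen (@parity_act2 a) (@parity_actC a)) /parity_act.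
by case: eqP.
Qed.

Lemma parityV a g : parity a g^-1 = parity a g.
Proof.
apply/eqP; rewrite -negb_add -parityM mulVg /parity.
by rewrite (racg_act1 (@parity_act2 a) (@parity_actC a)).
Qed.

Lemma parityJ a g h : parity a (g ^ h) = parity a g.
Proof. by rewrite conjgE !parityM parityV addbC -addbA addbb addbF. Qed.

Lemma gen_conj a b g : gen a ^ g = gen b -> a = b.
Proof.
move/(congr1 (parity b)); rewrite parityJ !parity_gen eqxx.
by move/eqP.
Qed.

Lemma gen_inj : injective gen.
Proof. by move=> a b ab; apply: (@gen_conj a b 1); rewrite conjg1. Qed.

(** * Length *)

Lemma len_exists g : exists n, `[< exists2 w, word w = g & size w = n >].
Proof. by exists (size (repr g)); apply/asboolP; exists (repr g); rewrite ?word_repr. Qed.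

Definition len g : nat := ex_minn (len_exists g).
Arguments len g%_group_scope.

Lemma len_word w : (len (word w) <= size w)%N.
Proof.
rewrite /len; case: ex_minnP => n _; apply.
by apply/asboolP; exists w.
Qed.

Lemma len_min_word g : exists2 w, word w = g & size w = len g.
Proof. by rewrite /len; case: ex_minnP => n /asboolP[w <- <-] _; exists w. Qed.

Lemma lenM g h : (len (g * h) <= len g + len h)%N.
Proof.
have [w1 <- <-] := len_min_word g; have [w2 <- <-] := len_min_word h.
by rewrite -word_cat -size_cat len_word.
Qed.

Lemma lenV_le g : (len g^-1 <= len g)%N.
Proof.
by have [w <- <-] := len_min_word g; rewrite -word_rev -(size_rev w) len_word.
Qed.

Lemma lenV g : len g^-1 = len g.
Proof.
by apply/eqP; rewrite eqn_leq lenV_le /= -{1}(invgK g) lenV_le.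
Qed.

Definition minimal w := size w = len (word w).

Lemma minimal_cat w1 w2 : minimal (w1 ++ w2) -> minimal w1 /\ minimal w2.
Proof.
rewrite /minimal size_cat word_cat => eq12.
have := lenM (word w1) (word w2); have := len_word w1; have := len_word w2.
rewrite -eq12; lia.
Qed.

Lemma finite_len_le n : finite_set [set g | (len g <= n)%N].
Proof.
apply: (@sub_finite_set _ _
  ((fun w : {k : 'I_n.+1 & k.-tuple V} => word (tagged w)) @` setT)).
  move=> g /= leg; have [w wg sw] := len_min_word g.
  have ltw : (size w < n.+1)%N by rewrite sw.
  exists (@Tagged _ (Ordinal ltw) (fun k : 'I_n.+1 => k.-tuple V) (in_tuple w)) => //.
exact/finite_image/finite_finset.
Qed.

(** * Walls *)

(** A letter v read after the prefix p crosses the wall of p v p^-1; conjugating r by the letters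
    already read turns this into a comparison with [gen v]. *)
Fixpoint crossing w r : bool :=
  if w is v :: w' then (r == gen v) (+) crossing w' (r ^ gen v) else false.

Lemma crossing_cat w1 w2 r :
  crossing (w1 ++ w2) r = crossing w1 r (+) crossing w2 (r ^ word w1).
Proof.
elim: w1 r => [|v w1 IHw] r /=; first by rewrite word_nil conjg1.
by rewrite IHw word_cons conjgM addbA.
Qed.

Lemma gen_conj_comm v z : e v z -> gen v ^ gen z = gen v.
Proof. by move=> vz; rewrite conjgE genV (racg_gen_comm vz) genK. Qed.

Lemma conj_genK v g : (g ^ gen v) ^ gen v = g.
Proof. by rewrite -conjgM racg_gen_square conjg1. Qed.

(** A factor v v crosses one wall twice; exchanging two commuting letters exchanges the walls that
    they cross. *)
Lemma crossing_eq w1 w2 r : racg_eq e w1 w2 -> crossing w1 r = crossing w2 r.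
Proof.
move=> h; elim: h r => {w1 w2}
  [//|w1 w2 _ IH r|w1 w2 w3 _ h1 _ h2 r|s t v r|s t v z vz r].
- by rewrite IH.
- by rewrite h1 h2.
- rewrite !crossing_cat /= word_cons conjgM conj_genK addbF; congr (_ (+) _).
  have -> : ((r ^ word s) ^ gen v == gen v) = (r ^ word s == gen v).
    by rewrite -{2}[gen v](commute_conj (commute_refl (gen v))) conjg_eq.
  by rewrite addbb.
- rewrite !crossing_cat /= !word_cons !word_nil !mulg1 (racg_gen_comm vz) !addbF.
  congr (_ (+) (_ (+) _)).
  have zv : gen z ^ gen v = gen z.
    exact/commute_conj/commute_sym/racg_gen_comm.
  rewrite -[X in _ ^ gen v == X]zv -[X in _ ^ gen z == X](gen_conj_comm vz) !conjg_eq.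
  exact: addbC.
Qed.

(* The parity of the number of times that a gallery from 1 to g crosses the
   wall of the reflection r. *)
Definition sep g r : bool := crossing (repr g) r.

Lemma sep_word w r : sep (word w) r = crossing w r.
Proof. exact/crossing_eq/racg_repr_pi. Qed.

Lemma sep1 r : sep 1 r = false.
Proof. exact: (sep_word [::]). Qed.

Lemma sep_gen v r : sep (gen v) r = (r == gen v).
Proof. by rewrite (sep_word [:: v]) /= addbF. Qed.

Lemma sepM g h r : sep (g * h) r = sep g r (+) sep h (r ^ g).
Proof.
by rewrite -{1}(word_repr g) -{1}(word_repr h) -word_cat sep_word crossing_cat word_repr.
Qed.

Lemma sepV g r : sep g^-1 r = sep g (r ^ g^-1).
Proof. by apply/eqP; rewrite -negb_add -{1}[r](conjgKV g) addbC -sepM mulgV sep1. Qed.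

Lemma sep_gen_gen v : sep (gen v) (gen v).
Proof. by rewrite sep_gen. Qed.

Lemma sep_genM v g r : sep (gen v * g) r = (r == gen v) (+) sep g (r ^ gen v).
Proof. by rewrite sepM sep_gen. Qed.

Lemma sep_genM_gen v g : sep (gen v * g) (gen v) = ~~ sep g (gen v).
Proof. by rewrite sep_genM eqxx conjgE mulKg. Qed.

Lemma refl_invol v g : (gen v ^ g) * (gen v ^ g) = 1.
Proof. by rewrite -conjMg racg_gen_square conj1g. Qed.

Lemma sep_refl v g : sep (gen v ^ g) (gen v ^ g).
Proof.
by rewrite {1}conjgE sepM sepV conjgK sep_genM_gen; case: sep.
Qed.

(** The strong exchange condition: folding the gallery along the wall deletes a letter that crosses
    it. *)
Lemma crossing_split w r : crossing w r -> exists w1 v w2,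
  [/\ w = w1 ++ v :: w2, r ^ word w1 = gen v & r * word w = word (w1 ++ w2)].
Proof.
elim: w r => [//|v w IHw] r /=.
have [->|rv] /= := eqVneq r (gen v).
  by move=> _; exists [::], v, w; rewrite word_nil conjg1 word_cons genK.
move=> /IHw[w1 [z [w2 [ww rz rw]]]]; exists (v :: w1), z, w2; split => //=.
- by rewrite ww.
- by rewrite word_cons conjgM.
by rewrite !word_cons -rw conjgE !mulgA mulgV mul1g.
Qed.

Lemma sep_len g r : sep g r -> (len (r * g) < len g)%N.
Proof.
have [w <- sw] := len_min_word g; rewrite sep_word.
move=> /crossing_split[w1 [v [w2 [ww _ ->]]]].
rewrite -sw ww size_cat /= addnS ltnS -size_cat; exact: len_word.
Qed.

Lemma sep_wall g r : sep g r -> exists v h, r ^ h = gen v.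
Proof.
rewrite -(word_repr g) sep_word => /crossing_split[w1 [v [_ [_ h _]]]].
by exists v, (word w1).
Qed.

Lemma sep_invol g r : sep g r -> r * r = 1.
Proof.
move=> /sep_wall[v [h rh]]; apply: (@conjg_inj _ h).
by rewrite conjMg rh racg_gen_square conj1g.
Qed.

(** A shortest gallery crosses a wall at most once: if both pieces crossed it, reflecting them would
    shorten both without changing their product. *)
Lemma minimal_sep w1 w2 r : minimal (w1 ++ w2) ->
  sep (word w1) r -> sep (word (w1 ++ w2)) r.
Proof.
move=> min12 s1; rewrite word_cat sepM s1; apply/negP => s2.
have [min1 min2] := minimal_cat min12.
have l1 := sep_len s1; have l2 := sep_len s2.
have := lenM (r * word w1) (r ^ word w1 * word w2).
have -> : r * word w1 * (r ^ word w1 * word w2) = word (w1 ++ w2).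
  by rewrite conjgE word_cat -!mulgA mulVKg (mulgA r r) (sep_invol s1) mul1g.
move: min12 min1 min2 (leq_add l1 l2); rewrite /minimal size_cat => <- -> ->.
by rewrite addSn addnS => /ltnW lt /(leq_trans lt); rewrite ltnn.
Qed.

Lemma sep_gen_first v g : sep g (gen v) ->
  exists2 w, minimal (v :: w) & word (v :: w) = g.
Proof.
move=> sg; have [w ww sw] := len_min_word (gen v * g).
have gw : word (v :: w) = g by rewrite word_cons ww genK.
exists w => //; rewrite /minimal gw /= sw; apply/eqP.
rewrite eqn_leq (sep_len sg) /= -sw -gw; exact: len_word.
Qed.

Lemma minimal_first v w : minimal (v :: w) -> sep (word (v :: w)) (gen v).
Proof.
by move=> m; apply: (@minimal_sep [:: v] w) => //; exact: (sep_gen_gen v).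
Qed.

(** * Special subgroups *)

Definition special (T : {pred V}) g := exists2 w, all [in T] w & word w = g.

Section Special.
Variable T : {pred V}.

Lemma special1 : special T 1.
Proof. by exists [::]. Qed.

Lemma special_gen v : v \in T -> special T (gen v).
Proof. by move=> vT; exists [:: v]; rewrite //= vT. Qed.

Lemma specialM g h : special T g -> special T h -> special T (g * h).
Proof.
move=> [w1 h1 <-] [w2 h2 <-]; exists (w1 ++ w2); last exact: word_cat.
by rewrite all_cat h1.
Qed.

Lemma specialV g : special T g -> special T g^-1.
Proof.
by move=> [w h <-]; exists (rev w); rewrite ?all_rev // word_rev.
Qed.

Lemma specialX g n : special T g -> special T (g ^+ n).
Proof.
move=> Tg; elim: n => [|n IHn]; first exact: special1.
by rewrite expgS; exact: specialM.
Qed.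

Lemma special_ind (P : W -> Prop) :
  P 1 -> (forall v g, v \in T -> special T g -> P g -> P (gen v * g)) ->
  forall g, special T g -> P g.
Proof.
move=> P1 PM g [w + <-]; elim: w => [//|v w IHw] /= /andP[vT wT].
by rewrite word_cons; apply: PM => //; [exists w|exact: IHw].
Qed.

Lemma special_sep g r : special T g -> sep g r ->
  exists v h, [/\ v \in T, special T h & r = gen v ^ h].
Proof.
move=> [w wT <-]; rewrite sep_word => /crossing_split[w1 [v [w2 [ww h _]]]].
move: wT; rewrite ww all_cat /= => /and3P[w1T vT _].
exists v, (word w1)^-1; split => //; first by apply: specialV; exists w1.
by rewrite -h conjgK.
Qed.

Lemma special_commute q g :
  (forall v, v \in T -> commute q (gen v)) -> special T g -> commute q g.
Proof.
move=> qT; elim/special_ind => [|v h vT _ qh]; first exact: commute1.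
exact: commuteM (qT v vT) qh.
Qed.

(* x is a shortest element of the right coset of g. *)
Lemma special_coset g : exists d x, [/\ special T d, g = d * x &
  forall v h, v \in T -> special T h -> ~~ sep x (gen v ^ h)].
Proof.
pose P (x : W) := exists2 d, special T d & g = d * x.
have exP : exists x, P x.
  by exists g; exists 1; [exact: special1|rewrite mul1g].
have [x [d Td gdx] min_x] := @ex_min_nat W P len exP; exists d, x; split => //.
move=> v h vT hT; apply/negP => /[dup] sx /sep_len; rewrite ltnNge => /negP; apply.
apply: min_x; exists (d * (gen v ^ h)).
  by apply: specialM => //; rewrite conjgE; apply: specialM;
    [exact: specialV|apply: specialM => //; exact: special_gen].
by rewrite -mulgA [_ * (_ * x)]mulgA (sep_invol sx) mul1g.
Qed.

End Special.

(** * Non-adjacent generators *)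

Section Dihedral.
Variables (a b : V).
Hypotheses (ab : a != b) (nab : ~~ e a b) (nba : ~~ e b a).

(* The action of the infinite dihedral quotient on the integers, in which a
   and b are the reflections in -1/2 and 1/2. *)
Definition dihedral_act v (n : int) : int :=
  (if v == a then - 1 - n else if v == b then 1 - n else n)%R.

Lemma dihedral_act2 v n : dihedral_act v (dihedral_act v n) = n.
Proof. by rewrite /dihedral_act; case: eqP => [_|_]; [lia|case: eqP => _; lia]. Qed.

Lemma dihedral_actC v z n : e v z ->
  dihedral_act v (dihedral_act z n) = dihedral_act z (dihedral_act v n).
Proof.
move=> vz; rewrite /dihedral_act.
have [va|va] := eqVneq v a; have [za|za] := eqVneq z a; rewrite ?za //.
- by have [zb|//] := eqVneq z b; move: vz nab; rewrite va zb => ->.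
- by have [vb|//] := eqVneq v b; move: vz nba; rewrite za vb => ->.
by case: eqP => //; case: eqP.
Qed.

Lemma dihedral_act_norm v n : (`|dihedral_act v n| <= `|n|.+1)%N.
Proof. by rewrite /dihedral_act; case: eqP => [_|_]; [lia|case: eqP => _; lia]. Qed.

Lemma dihedral_word_norm w : (`|foldr dihedral_act 0%R w| <= size w)%N.
Proof.
elim: w => [//|v w IHw] /=; apply: leq_trans (dihedral_act_norm _ _) _.
by rewrite ltnS.
Qed.

Definition dihedral_pos := racg_act dihedral_act.

Lemma dihedral_posM g h n : dihedral_pos (g * h) n = dihedral_pos g (dihedral_pos h n).
Proof. exact: (racg_actM dihedral_act2 dihedral_actC). Qed.

Lemma dihedral_pos1 n : dihedral_pos 1 n = n.
Proof. exact: (racg_act1 dihedral_act2 dihedral_actC). Qed.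

Lemma dihedral_pos_gen v n : dihedral_pos (gen v) n = dihedral_act v n.
Proof. exact: (racg_act_gen dihedral_act2 dihedral_actC). Qed.

Lemma dihedral_pos_word w n : dihedral_pos (word w) n = foldr dihedral_act n w.
Proof. exact: (racg_act_word dihedral_act2 dihedral_actC). Qed.

Lemma dihedral_pos_len g : (`|dihedral_pos g 0|%N <= len g)%N.
Proof.
have [w <- <-] := len_min_word g; rewrite dihedral_pos_word.
exact: dihedral_word_norm.
Qed.

Lemma gen_noncommute : ~ commute (gen a) (gen b).
Proof.
move=> /(congr1 (dihedral_pos^~ 0%R)); rewrite !dihedral_posM !dihedral_pos_gen.
by rewrite /dihedral_act !eqxx eq_sym (negbTE ab).
Qed.

Fixpoint alternating w := if w is v :: w' then
  (if w' is z :: _ then v != z else true) && alternating w' else true.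

Lemma alternating_pos w : all [in pred2 a b] w -> alternating w ->
  foldr dihedral_act 0%R w =
    (if w is v :: _ then if v == a then - (size w)%:Z else (size w)%:Z else 0)%R.
Proof.
elim: w => [//|v [|z w] IHw] /=.
  by rewrite andbT => /orP[] /eqP -> _; rewrite /dihedral_act ?eqxx // eq_sym (negbTE ab).
move=> /and3P[vab zab wab] /andP[vz altw].
have /= -> := IHw (introT andP (conj zab wab)) altw.
rewrite /dihedral_act; case/orP: vab => /eqP va; case/orP: zab => /eqP za;
  move: vz; rewrite va za ?eqxx // => _;
  rewrite ?(negbTE ab) ?[b == a]eq_sym ?(negbTE ab); lia.
Qed.

Lemma not_alternating w : ~~ alternating w ->
  exists w1 v w2, w = w1 ++ v :: v :: w2.
Proof.
elim: w => [//|v [//|z w] IHw].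
have [->|vz] := eqVneq v z; first by exists [::], z, w.
rewrite /= vz => /IHw[w1 [y [w2 ->]]]; by exists (v :: w1), y, w2.
Qed.

(** A shortest word in a and b is alternating, so the position of g is plus or minus its length. One
    of the two reflections moves this position further from 0, although both would shorten the
    word. *)
Lemma special_pair_sep g : special (pred2 a b) g -> sep g (gen a) -> ~~ sep g (gen b).
Proof.
pose P w := all [in pred2 a b] w /\ word w = g.
move=> [w0 w0T w0g]; have exP : exists w, P w by exists w0.
have [w [wT wg] min_w] := @ex_min_nat _ P size exP => {w0 w0T w0g exP}.
have short z : sep g (gen z) ->
    exists w', [/\ all [in pred2 a b] w', word w' = gen z * g & (size w' < size w)%N].
  rewrite -wg sep_word => /crossing_split[w1 [v [w2 [ww _ wz]]]].
  move: wT; rewrite ww all_cat /= => /and3P[w1T _ w2T].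
  exists (w1 ++ w2); split; first by rewrite all_cat w1T.
    by rewrite -wz ww.
  by rewrite !size_cat /= addnS.
have alt : alternating w.
  apply: contraT => /not_alternating[w1 [v [w2 ww]]].
  have : P (w1 ++ w2).
    move: wT wg; rewrite ww /P !all_cat /= !word_cat !word_cons genK.
    by move=> /and4P[-> _ _ ->] ->.
  by move/min_w; rewrite ww !size_cat /=; lia.
move=> /short[w1 [w1T w1g lt1]]; apply/negP => /short[w2 [w2T w2g lt2]].
have := dihedral_word_norm w1; have := dihedral_word_norm w2.
rewrite -!dihedral_pos_word w1g w2g !dihedral_posM !dihedral_pos_gen -wg.
rewrite !dihedral_pos_word (alternating_pos wT alt) /dihedral_act !eqxx.
rewrite [b == a]eq_sym (negbTE ab).
by case: (w) lt1 lt2 => [//|v w'] /=; case: ifP => _; lia.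
Qed.

(** Neither wall is crossed by the shortest representative of the coset of g, which leaves the case
    of the dihedral subgroup. *)
Lemma sep_disjoint g : sep g (gen a) -> ~~ sep g (gen b).
Proof.
have [d [x [Td -> sx]]] := special_coset (pred2 a b) g.
have xJ z : z \in pred2 a b -> sep x (gen z ^ d) = false.
  by move=> zT; apply/negbTE/sx.
rewrite !sepM !xJ ?addbF; first exact: special_pair_sep.
all: by rewrite !inE eqxx ?orbT.
Qed.

End Dihedral.

(** * Commuting reflections *)

Hypothesis e_sym : symmetric e.

Definition star v := [pred z | (z == v) || e v z].

Lemma star_sym v z : (z \in star v) = (v \in star z).
Proof. by rewrite !inE eq_sym e_sym. Qed.

Lemma star_commute v z : z \in star v -> commute (gen v) (gen z).
Proof. by rewrite inE => /orP[/eqP ->//|/racg_gen_comm]. Qed.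

Lemma commute_star v z : commute (gen v) (gen z) -> z \in star v.
Proof.
move=> vz; apply: contraT; rewrite inE negb_or => /andP[nvz ne].
case: (@gen_noncommute v z _ _ _ vz) => //; first by rewrite eq_sym.
by rewrite e_sym.
Qed.

Lemma star_disjoint v z g : z \notin star v -> sep g (gen v) -> ~~ sep g (gen z).
Proof.
rewrite inE negb_or => /andP[vz ne]; apply: sep_disjoint => //.
  by rewrite eq_sym.
by rewrite e_sym.
Qed.

Lemma len_ind (P : W -> Prop) :
  (forall g, (forall h, (len h < len g)%N -> P h) -> P g) -> forall g, P g.
Proof.
move=> IH g; have [n] := ubnP (len g); elim: n g => // n IHn g ltn.
by apply: IH => h lth; apply: IHn; exact: leq_trans lth ltn.
Qed.

(** The first letter z of a shortest word for g must be in the star of v: if g is not beyond the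
    wall of v, then gen v * g = g * gen v is beyond it and would also be beyond the disjoint wall of
    z. *)
Lemma centralizer_gen v g : commute g (gen v) -> special (star v) g.
Proof.
elim/len_ind: g => g IHg cgv.
have [sgv|nsgv] := boolP (sep g (gen v)).
  rewrite -[g](genK v); apply: specialM; first by apply: special_gen; rewrite inE eqxx.
  by apply: IHg; [exact: sep_len|exact/commute_sym/commuteM/commute_sym].
have [w wg sw] := len_min_word g; case: w wg sw => [<- _|z w wg sw].
  exact: special1.
have min_zw : minimal (z :: w) by rewrite /minimal sw wg.
have sgz := minimal_first min_zw; rewrite wg in sgz.
have [vz|nvz] := boolP (z \in star v).
  rewrite -[g](genK z); apply: specialM; first exact: special_gen.
  apply: IHg; first exact: sep_len.
  by apply/commute_sym/commuteM; [exact: star_commute|exact: commute_sym].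
have := @star_disjoint v z (gen v * g) nvz; rewrite sep_genM_gen nsgv.
rewrite -cgv sepM sgz sep_gen.
have [/gen_conj zv|_] := eqVneq (gen z ^ g) (gen v); last by move=> /(_ isT).
by move: nvz; rewrite zv inE eqxx.
Qed.

(* r ^ g = gen v means that the chamber g is adjacent to the wall of r. *)
Lemma adjacent_same_side r q g h v z : ~ commute r q ->
  r ^ g = gen v -> r ^ h = gen z -> sep g q = sep h q.
Proof.
move=> nrq rg rh.
have vz : v = z.
  by apply: (@gen_conj v z (g^-1 * h)); rewrite -rg conjgM conjgK.
(* One passes from g to h along the wall of r, using letters in the star of v; all walls met on the
   way commute with r. *)
have : special (star v) (g^-1 * h).
  apply/centralizer_gen/commute_sym/conj_commute.
  by rewrite -rg conjgM conjgK rh rg vz.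
rewrite -{2}[h](mulVKg g); move: (g^-1 * h) => x sx.
rewrite sepM; have [sxq|] := boolP (sep x (q ^ g)); last by rewrite addbF.
have [y [k [yT kT qe]]] := special_sep sx sxq; case: nrq.
apply/(commuteJE _ _ g); rewrite rg qe.
have vk : commute (gen v) k.
  by apply: special_commute kT => ? /star_commute.
rewrite -(commute_conj vk); apply: commuteJ; exact: star_commute.
Qed.

(** Crossing walls share a chamber: both touch k, since k centralizes [gen v]. The induction removes
    the first letter of h. *)
Lemma commuting_walls v z h : commute (gen v) (gen z ^ h^-1) ->
  exists2 k, commute (gen v) k & gen z ^ h^-1 = gen z ^ k^-1.
Proof.
elim/len_ind: h => h IHh cvh.
have JM y g : gen z ^ (gen y * g)^-1 = (gen z ^ g^-1) ^ gen y.
  by rewrite invgM conjgM genV.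
have [shv|nshv] := boolP (sep h (gen v)).
  have [k vk hk] : exists2 k, commute (gen v) k & gen z ^ (gen v * h)^-1 = gen z ^ k^-1.
    apply: IHh; first exact: sep_len.
    by rewrite JM -{1}(commute_conj (commute_refl (gen v))); exact: commuteJ.
  exists k => //; rewrite -hk JM [RHS]commute_conj //; exact: commute_sym.
have [w wh sw] := len_min_word h; case: w wh sw => [wh _|y w wh sw].
  by exists 1; [exact: commute1|rewrite -wh word_nil].
have min_yw : minimal (y :: w) by rewrite /minimal sw wh.
have shy := minimal_first min_yw; rewrite wh in shy.
have hyh : gen z ^ h^-1 = (gen z ^ (gen y * h)^-1) ^ gen y by rewrite -JM genK.
have [vy|nvy] := boolP (y \in star v).
  have cvy := star_commute vy.
  have [k vk hk] : exists2 k, commute (gen v) k & gen z ^ (gen y * h)^-1 = gen z ^ k^-1.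
    apply: IHh; first exact: sep_len.
    by rewrite JM -{1}(commute_conj cvy); exact: commuteJ.
  exists (gen y * k); first exact: commuteM.
  by rewrite JM -hk.
have [cy|ncy] := pselect (commute (gen z ^ h^-1) (gen y)).
  have hE : gen z ^ (gen y * h)^-1 = gen z ^ h^-1 by rewrite JM commute_conj.
  by rewrite -hE; apply: IHh; [exact: sep_len|rewrite hE].
(* Both h and gen v * h touch the second wall, hence are on the same side of the wall of y; so gen v
   * h would be beyond the disjoint walls of v and y. *)
have := @adjacent_same_side _ (gen y) h (gen v * h) z z ncy.
rewrite conjgKV conjgM [_ ^ gen v]commute_conj ?conjgKV; last exact: commute_sym.
move=> /(_ erefl erefl) /esym; rewrite shy => svhy.
have := star_disjoint nvy (g := gen v * h).
by rewrite sep_genM_gen nshv svhy => /(_ isT).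
Qed.

End Words.

Arguments len {V e} g%_group_scope.

(** * Automorphisms sending generators to conjugates *)

Section Automorphisms.
Local Open Scope group_scope.
Variables (V : finType) (e : rel V).
Hypothesis e_sym : symmetric e.
Local Notation W := (racg e).
Local Notation gen := (racg_gen e).
Implicit Types (u v a b z : V) (w : seq V) (g h r q x y : W).

(** A gallery from g to h crosses the wall of q. Just before, it touches this wall, and its side of
    r is already settled. *)
Lemma opposite_sides r q g g' u v h : ~ commute r q ->
    r ^ g = gen u -> q ^ g' = gen v ->
  sep h q != sep g q -> sep h r = sep g' r.
Proof.
move=> nrq rg qg'.
have nq1 : ~ commute (q ^ g) (gen u) by rewrite -rg => /commuteJE /commute_sym.
have [x ->] : exists x, h = g * x by exists (g^-1 * h); rewrite mulVKg.
have [x' gx'] : exists x', g' = g * x' by exists (g^-1 * g'); rewrite mulVKg.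
move: qg'; rewrite {}gx' conjgM !(sepM g) rg.
move: (q ^ g) nq1 => q1 nq1 q1x' sx.
have {}sx : sep x q1 by move: sx; case: (sep x q1); rewrite ?addbF ?eqxx.
congr (_ (+) _).
(* If the gallery has to cross the wall of [gen u], it does so with its first letter, hence before
   that of q1. *)
have [w [min_w wx w_first]] : exists w, [/\ minimal e w, word e w = x &
    sep x (gen u) -> exists w', w = u :: w'].
  have [/sep_gen_first[w mw wx]|_] := boolP (sep x (gen u)).
    by exists (u :: w); split=> // _; exists w.
  by have [w wx sw] := len_min_word x; exists w; split=> //; rewrite /minimal wx.
move: sx; rewrite -{1}wx sep_word => /crossing_split[s [z [s' [ws qs _]]]].
have min_s : minimal e s by move: min_w; rewrite ws => /minimal_cat[].
have -> : sep x (gen u) = sep (word e s) (gen u).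
  have [sxu|/negbTE sxu] := boolP (sep x (gen u)).
    have [w' ww'] := w_first sxu; case: s ws qs min_s => [|u' s] ws qs min_s.
      move: ws qs; rewrite ww' word_nil conjg1 /= => -[<- _] q1u.
      by case: nq1; rewrite q1u; exact: commute_refl.
    move: ws min_s; rewrite ww' /= => -[<- _] min_s; symmetry.
    exact: minimal_first.
  symmetry; apply/negbTE/negP => ss; move: sxu; rewrite -wx ws minimal_sep //.
  by rewrite -ws.
exact: (adjacent_same_side e_sym nq1 qs q1x').
Qed.

Lemma common_chamber r q g h u v : r ^ g = gen u -> q ^ h = gen v ->
  commute r q -> exists2 y, r ^ y = gen u & q ^ y = gen v.
Proof.
move=> rg qh crq.
have qE : q ^ g = gen v ^ (g^-1 * h)^-1.
  by rewrite -qh -conjgM invgM invgK mulgA mulgV mul1g.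
have [k uk qk] : exists2 k, commute (gen u) k & gen v ^ (g^-1 * h)^-1 = gen v ^ k^-1.
  by apply: (commuting_walls e_sym); rewrite -qE -rg; exact: commuteJ.
exists (g * k); rewrite conjgM; first by rewrite rg commute_conj.
by rewrite qE qk conjgKV.
Qed.

(** Walk to a chamber y at the crossing of the walls, through the wall of r, and back by y^-1: q is
    crossed equally often out and back. *)
Lemma sep_commuting r q g h u v : r ^ g = gen u -> q ^ h = gen v ->
  commute r q -> u != v -> sep r q = false.
Proof.
move=> rg qh crq uv; have [y ry qy] := common_chamber rg qh crq.
have vu : gen v ^ gen u = gen v.
  by rewrite -qy -ry; apply: commute_conj; exact/commuteJ/commute_sym.
rewrite -[r](conjgK y) ry conjgE invgK sepM qy sep_genM vu sepV.
rewrite (inj_eq (@gen_inj _ _)) [v == u]eq_sym (negbTE uv) -qy conjgK.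
exact: addbb.
Qed.

Lemma sep_first x : x != 1 -> exists v, sep x (gen v).
Proof.
have [[|v w] wx sw] := len_min_word x; first by rewrite -wx eqxx.
by exists v; rewrite -wx; apply: minimal_first; rewrite /minimal wx.
Qed.

Definition special_aut (f : W -> W) :=
  [/\ bijective f, {morph f : x y / x * y} &
      forall v, exists g, f (gen v) ^ g = gen v].

(* The walls of f (gen u) and f (gen v) are disjoint exactly when u is not in the
   star of v; f (gen u) ^ g = gen u means that g is adjacent to the former. *)
Definition one_sided (f : W -> W) v := exists b : bool, forall u g,
  u \notin star e v -> f (gen u) ^ g = gen u -> sep g (f (gen v)) = b.

Section Special_Aut.
Variable f : W -> W.
Hypothesis fP : special_aut f.

Let fM : {morph f : x y / x * y}. Proof. by case: fP. Qed.
Let fI : injective f. Proof. by case: fP => /bij_inj. Qed.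
Let fS v : exists g, f (gen v) ^ g = gen v. Proof. by case: fP. Qed.

Lemma special_aut1 : f 1 = 1.
Proof. by apply: (@mulgI _ (f 1)); rewrite -fM !mulg1. Qed.

Lemma special_autJ x y : f (x ^ y) = f x ^ f y.
Proof.
have fV g : f g^-1 = (f g)^-1.
  by apply/esym/mulg1_eq; rewrite -fM mulgV special_aut1.
by rewrite !conjgE !fM fV.
Qed.

Lemma special_aut_commute u v : u \in star e v -> commute (f (gen u)) (f (gen v)).
Proof. by move=> /star_commute h; rewrite /commute -!fM h. Qed.

Lemma special_aut_noncommute u v : u \notin star e v ->
  ~ commute (f (gen u)) (f (gen v)).
Proof.
move=> /negP nuv; rewrite /commute -!fM => /fI h; apply: nuv.
exact/(commute_star e_sym)/commute_sym.
Qed.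

Lemma special_aut_refl v : sep (f (gen v)) (f (gen v)).
Proof. by have [g fg] := fS v; rewrite -[f _](conjgK g) fg sep_refl. Qed.

Lemma special_aut_sep u v : u \in star e v -> u != v ->
  sep (f (gen u)) (f (gen v)) = false.
Proof.
move=> uv; have [g fg] := fS u; have [h fh] := fS v.
exact: sep_commuting fg fh (special_aut_commute uv).
Qed.

Lemma special_aut_invol v : f (gen v) * f (gen v) = 1.
Proof. by rewrite -fM racg_gen_square special_aut1. Qed.

(** The walls of u and u' share a chamber. Hence the side of v on which the wall of u lies depends
    only on the component of u in the complement of the star of v. *)
Lemma adjacent_side u u' v g g' :
    u \notin star e v -> u' \notin star e v -> u' \in star e u ->
    f (gen u) ^ g = gen u -> f (gen u') ^ g' = gen u' ->
  sep g (f (gen v)) = sep g' (f (gen v)).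
Proof.
move=> nuv nu'v u'u fg fg'.
have [y uy u'y] := common_chamber fg fg' (commute_sym (special_aut_commute u'u)).
rewrite (adjacent_same_side e_sym (special_aut_noncommute nuv) fg uy).
exact: adjacent_same_side (special_aut_noncommute nu'v) u'y fg'.
Qed.

Section Inner.
Hypothesis f1 : forall v, one_sided f v.

Let side : exists b : V -> bool, forall v u g,
  u \notin star e v -> f (gen u) ^ g = gen u -> sep g (f (gen v)) = b v.
Proof.
pose P v (b : bool) := forall u g,
  u \notin star e v -> f (gen u) ^ g = gen u -> sep g (f (gen v)) = b.
by have [b bP] := @choice _ _ P f1; exists b.
Qed.

(* The intersection of the half-spaces containing the other walls is a
   fundamental domain of the group generated by the f (gen v), hence a single
   chamber since f is onto. *)
Lemma one_sided_inner : exists g0, forall x, f x = g0 * x * g0^-1.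
Proof.
have [b bP] := side; pose P v h := sep h (f (gen v)) == b v.
have nest u v h : u \notin star e v -> ~~ P v h -> P u h.
  move=> nuv; have [g fg] := fS u; have [g' fg'] := fS v.
  rewrite /P -(bP v u g) // -(bP u v g') //; last by rewrite star_sym.
  by move=> /(opposite_sides (special_aut_noncommute nuv) fg fg') ->.
have Prefl v h : P v (f (gen v) * h) = ~~ P v h.
  rewrite /P sepM special_aut_refl commute_conj; last exact: commute_refl.
  by case: sep; case: (b v).
have Pcomm u v h : u \in star e v -> u != v -> P v (f (gen u) * h) = P v h.
  move=> uv nuv; rewrite /P sepM special_aut_sep // commute_conj //.
  exact/commute_sym/special_aut_commute.
(* From a chamber violating P at the fewest vertices, move to a nearest one across a violated wall:
   this violates P at no new vertex. *)
have [g0 Pg0] : exists g0, forall v, P v g0.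
  have [g _ min_g] := @ex_min_nat W (fun=> True) (fun h => #|[set v | ~~ P v h]%SET|)
    (ex_intro _ 1 I).
  exists g => v; apply: contraT => nPv.
  have [g' Pg' min_g'] := @ex_min_nat W (P v) (fun h => len (g^-1 * h))
    (ex_intro _ (f (gen v) * g) (etrans (Prefl v g) nPv)).
  have Pmono u : P u g -> P u g'.
    move=> Pug; have [->//|uv] := eqVneq u v.
    have [su|nsu] := boolP (u \in star e v).
      apply: contraT => nPug'.
      have : sep (g^-1 * g') (f (gen u) ^ g).
        have := sepM g (g^-1 * g') (f (gen u)); rewrite mulVKg.
        by move: nPug' Pug; rewrite /P; case: sep; case: sep; case: (b u); case: sep.
      move=> /sep_len; rewrite conjgE -!mulgA mulVKg ltnNge min_g' //.
      by rewrite Pcomm.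
    have [w ww sw] := len_min_word (g^-1 * g').
    case: (lastP w) ww sw => [|w' s] ww sw.
      move: Pg'; rewrite -[g'](mulVKg g) -ww word_nil mulg1.
      by rewrite (negbTE nPv).
    have gE : g' = g * word e w' * gen s.
      by rewrite -mulgA -word_rcons ww mulVKg.
    have nP'' : ~~ P v (g * word e w').
      apply/negP => /min_g'; rewrite mulKg -sw size_rcons leqNgt ltnS.
      by rewrite len_word.
    have vs : f (gen v) ^ (g * word e w') == gen s.
      move: nP'' Pg'; rewrite gE /P [sep (_ * gen s) _]sepM sep_gen.
      by case: (f (gen v) ^ _ == gen s) => //; rewrite addbF => /negbTE ->.
    have := nest _ _ _ nsu nP''; rewrite gE /P [sep (_ * gen s) _]sepM sep_gen.
    rewrite -(eqP vs) conjg_eq (inj_eq fI) (inj_eq (@gen_inj _ _)) (negbTE uv).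
    by rewrite addbF.
  have := min_g g' I; rewrite leqNgt => /negP; case; apply: proper_card.
  apply/properP; split; last by exists v; rewrite !inE ?nPv // Pg'.
  by apply/fintype.subsetP => u; rewrite !inE; apply: contraNN => /Pmono.
(* Ping-pong: if x begins with u, then f x * g0 is beyond the wall of f (gen u), hence by [nest] not
   beyond that of any v outside the star of u. *)
have ping x : forall v, P v (f x * g0) = ~~ sep x (gen v).
  elim/len_ind: x => x IHx v.
  have Px u : sep x (gen u) -> P u (f x * g0) = false.
    move=> sxu; rewrite -[x](genK u) fM -mulgA Prefl IHx; last exact: sep_len.
    by rewrite sep_genM_gen sxu.
  have [/Px//|nsxv] := boolP (sep x (gen v)).
  have [->|/sep_first[u sxu]] := eqVneq x 1; first by rewrite special_aut1 mul1g Pg0.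
  have uv : u != v by apply: contraNneq nsxv => <-.
  have [suv|nsuv] := boolP (u \in star e v); last first.
    have nvu : v \notin star e u by rewrite star_sym.
    by rewrite (nest v u _ nvu) ?Px.
  rewrite -[x](genK u) fM -mulgA Pcomm // IHx; last exact: sep_len.
  rewrite sep_genM (inj_eq (@gen_inj _ _)) [v == u]eq_sym (negbTE uv).
  rewrite commute_conj ?nsxv ?(negbTE nsxv) //.
  exact: star_commute.
have uniq_g0 h : (forall v, P v h) -> h = g0.
  move=> Ph; have [[f' _ fK] _ _] := fP.
  have hE : h = f (f' (h * g0^-1)) * g0 by rewrite fK mulgVK.
  suff x1 : f' (h * g0^-1) = 1 by rewrite hE x1 special_aut1 mul1g.
  apply/eqP; apply: contraT => /sep_first[v sv].
  by have := ping (f' (h * g0^-1)) v; rewrite -hE Ph sv.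
(* The neighbour of g0 across its face s is not g0, so it violates P somewhere; the wall between
   them is that of some f (gen v), and v = s by types. *)
have fg0 s : f (gen s) ^ g0 = gen s.
  have : ~ forall v, P v (g0 * gen s).
    move=> /uniq_g0 /(canRL (mulKg _)); rewrite mulVg => gs1.
    by have := sep_gen_gen e s; rewrite gs1 sep1.
  move=> /existsNP[v /negP]; rewrite /P sepM sep_gen.
  have [fvs _|_] := eqVneq (f (gen v) ^ g0) (gen s); last first.
    by rewrite addbF => /negP[]; exact: Pg0.
  have [g fg] := fS v; rewrite -{1}[f _](conjgK g) fg -conjgM in fvs.
  by move: (gen_conj fvs) => vs; rewrite -[f _](conjgK g) -vs fg -conjgM fvs -vs.
exists g0 => x; have := Pg0; elim/word_ind: x => [|v x IHx] _.
  by rewrite special_aut1 mulg1 mulgV.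
by rewrite fM IHx // -[f (gen v)](conjgK g0) fg0 conjgE invgK -!mulgA mulKg.
Qed.

End Inner.
End Special_Aut.

(** * Partial conjugations *)

(* Separating intersection of links: no edge leaves K except into the common
   links of v and z. *)
Definition SIL v z (K : {set V}) :=
  [/\ v != z, ~~ e v z, K != finset.set0, v \notin K /\ z \notin K &
   forall x y : V, x \in K -> ~~ (e v x && e z x) /\
     (e x y -> y \in K \/ e v y && e z y)].

(* S is a union of connected components of the complement of the star of z. *)
Definition star_closed z (S : {set V}) :=
  (forall u, u \in S -> u \notin star e z) /\
  (forall u v, u \in S -> e u v -> v \notin star e z -> v \in S).

Definition is_partial_conj z (S : {set V}) (F : W -> W) :=
  {morph F : x y / x * y} /\
  forall u, F (gen u) = if u \in S then gen u ^ gen z else gen u.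

(** An edge leaving S ends in the star of z, at a generator unaffected by conjugation by [gen z]; so
    the commutation relations survive. *)
Lemma partial_conj_exists z (S : {set V}) : star_closed z S ->
  exists F, is_partial_conj z S F.
Proof.
move=> [Sz Scl].
have [||F [[FM Fg] _]] := @racg_universal V e W
    (fun u => if u \in S then gen u ^ gen z else gen u); last by exists F.
  move=> u; case: ifP => _; last exact: racg_gen_square.
  exact: refl_invol.
move=> u v uv; have cuv : commute (gen u) (gen v) by exact: racg_gen_comm.
have cross a b : e a b -> a \in S -> b \notin S -> commute (gen a ^ gen z) (gen b).
  move=> eab aS nbS; have bz : b \in star e z.
    by apply: contraNT nbS; exact: Scl eab.
  by rewrite -(commute_conj (commute_sym (star_commute bz))); apply/commuteJ/racg_gen_comm.
case: ifP => uS; case: ifP => vS.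
- exact: commuteJ.
- by apply: cross; rewrite ?vS.
- by apply/commute_sym/cross; rewrite ?uS // e_sym.
exact: cuv.
Qed.

Lemma morph_gen_eq (F G : W -> W) :
    {morph F : x y / x * y} -> {morph G : x y / x * y} ->
  (forall u, F (gen u) = G (gen u)) -> F =1 G.
Proof.
move=> FM GM FG x; elim/word_ind: x => [|v x IHx]; last by rewrite FM GM FG IHx.
have m1 (H : W -> W) : {morph H : x y / x * y} -> H 1 = 1.
  by move=> HM; apply: (@mulgI _ (H 1)); rewrite -HM !mulg1.
by rewrite !m1.
Qed.

Section Partial_Conj.
Variables (z : V) (S : {set V}) (F : W -> W).
Hypotheses (Scl : star_closed z S) (FP : is_partial_conj z S F).

Lemma partial_conj_center : F (gen z) = gen z.
Proof.
case: FP => _ ->; case: ifP => // zS; case: Scl => /(_ _ zS).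
by rewrite inE eqxx.
Qed.

Lemma partial_conjJ x y : F (x ^ y) = F x ^ F y.
Proof.
case: FP => FM _; have F1 : F 1 = 1 by apply: (@mulgI _ (F 1)); rewrite -FM !mulg1.
have FV g : F g^-1 = (F g)^-1 by apply/esym/mulg1_eq; rewrite -FM mulgV.
by rewrite !conjgE !FM FV.
Qed.

Lemma partial_conjK : involutive F.
Proof.
have [FM Fg] := FP; apply: (@morph_gen_eq (fun x => F (F x)) id) => // [x y|u].
  by rewrite !FM.
rewrite [F (gen u)]Fg; case: ifP => uS; last by rewrite Fg uS.
by rewrite partial_conjJ partial_conj_center Fg uS conj_genK.
Qed.

Section Composite.
Variable f : W -> W.
Hypothesis fP : special_aut f.

Let fM : {morph f : x y / x * y}. Proof. by case: fP. Qed.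

Lemma partial_conj_in u : u \in S -> f (F (gen u)) = f (gen u) ^ f (gen z).
Proof. by case: FP => _ -> ->; rewrite special_autJ. Qed.

Lemma partial_conj_notin u : u \notin S -> f (F (gen u)) = f (gen u).
Proof. by case: FP => _ -> /negbTE ->. Qed.

Lemma special_conjK x : (x ^ f (gen z)) ^ f (gen z) = x.
Proof. by rewrite -conjgM special_aut_invol // conjg1. Qed.

Lemma special_aut_partial_conj : special_aut (f \o F).
Proof.
have [fB _ fS] := fP; have [FM Fg] := FP; split.
- by apply: bij_comp => //; exact: inv_bij partial_conjK.
- by move=> x y; rewrite /= FM fM.
move=> v; have [g fg] := fS v; rewrite /=.
have [vS|vS] := boolP (v \in S); last by exists g; rewrite partial_conj_notin.
by exists (f (gen z) * g); rewrite partial_conj_in // conjgM special_conjK.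
Qed.

Lemma partial_conj_chamber u g : u \in S ->
  f (F (gen u)) ^ g = gen u -> f (gen u) ^ (f (gen z) * g) = gen u.
Proof. by move=> uS; rewrite partial_conj_in // conjgM. Qed.

Hypothesis noSIL : forall v z K, ~ SIL v z K.

(** Only walls of vertices in S move, by the reflection f (gen z). If z is in the star of v, this
    preserves the sides of v. Otherwise the vertices of S whose walls end up on the wrong side would
    form a SIL with v and z. *)
Lemma partial_conj_one_sided_notin v : v != z -> v \notin S ->
  one_sided f v -> one_sided (f \o F) v.
Proof.
move=> vz vS [b bP]; exists b => u g uv /=; rewrite (partial_conj_notin vS).
have [uS|uS] := boolP (u \in S); last by rewrite partial_conj_notin //; exact: bP.
have [zv fug|nzv] := boolP (z \in star e v).
  have := bP _ _ uv (partial_conj_chamber uS fug).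
  rewrite sepM special_aut_sep 1?eq_sym // commute_conj //.
  exact/commute_sym/special_aut_commute.
have nvz : v \notin star e z by rewrite star_sym.
have [Sz Scl'] := Scl; have f'P := special_aut_partial_conj.
have fz' : f (F (gen v)) = f (gen v) by exact: partial_conj_notin.
have nSv (x : V) : x \in S -> x \notin star e v.
  move=> xS; apply: contra vS; rewrite inE => /orP[/eqP <- //|vx].
  by apply: Scl' nvz; [exact: xS|rewrite e_sym].
pose bad (x : V) := exists h, f (F (gen x)) ^ h = gen x /\ sep h (f (gen v)) <> b.
pose K := [set x : V in S | `[< bad x >]]%SET.
move=> fug; apply: contrapT => sg; apply: (noSIL (v := v) (z := z) (K := K)).
have KS (x : V) : x \in K -> x \in S by rewrite inE => /andP[].
have zNS : z \notin S by apply/negP => /Sz; rewrite inE eqxx.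
split=> //.
- by apply: contraNN nzv; rewrite inE => ->; rewrite orbT.
- by apply/finset.set0Pn; exists u; rewrite inE uS; apply/asboolP; exists g.
- by split; [apply: contraNN vS|apply: contraNN zNS]; exact: KS.
move=> x y xK; have xS := KS x xK; split.
  by have := Sz x xS; rewrite inE negb_or => /andP[_ /negbTE ->]; rewrite andbF.
move=> xy; move: xK; rewrite inE => /andP[_ /asboolP[h [fxh sh]]].
have side (y' : V) k : y' \notin star e v -> y' \in star e x -> f (F (gen y')) ^ k = gen y' ->
    sep k (f (gen v)) <> b.
  move=> nyv yx fyk; rewrite -fz'.
  by rewrite -(adjacent_side f'P (nSv x xS) nyv yx fxh fyk) /= fz'.
have yx : y \in star e x by rewrite inE xy orbT.
have [yz|nyz] := boolP (y \in star e z); last first.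
  have yS : y \in S by exact: Scl' xy nyz.
  left; rewrite inE yS; apply/asboolP.
  have [_ _ /(_ y)[k fyk]] := f'P; exists k; split => //.
  exact: side (nSv y yS) yx fyk.
have [yv|nyv] := boolP (y \in star e v).
  right; move: yz yv; rewrite !inE => /orP[/eqP yz|zy].
    by move: (Sz x xS); rewrite inE e_sym -yz xy orbT.
  move=> /orP[/eqP yv|->//].
  by move: nvz; rewrite inE -yv zy orbT.
(* Now y is in the star of z but not of v. Its wall lies on the same side of v as that of x, the
   wrong one, and as that of z, the right one. *)
have [_ _ /(_ y)[k fyk]] := f'P; case: (side y k nyv yx fyk).
have [_ _ /(_ z)[l fzl]] := f'P.
rewrite -fz' (adjacent_side f'P nyv nzv _ fyk fzl) /=; last by rewrite star_sym.
rewrite fz'; apply: bP nzv _.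
by move: fzl; rewrite /= partial_conj_notin.
Qed.

End Composite.
End Partial_Conj.

Lemma one_sided_conj f f' k v : f =1 (fun x => f' x ^ k) ->
  one_sided f' v -> one_sided f v.
Proof.
move=> ff' [b bP]; exists (sep k (f' (gen v)) (+) b) => u g uv.
rewrite !ff' -conjgM => /(bP _ _ uv) <-.
by rewrite sepM addbA addbb.
Qed.

Lemma star_closedC z S : star_closed z S ->
  star_closed z [set u | (u \notin S) && (u \notin star e z)]%SET.
Proof.
move=> [Sz Scl]; split=> [u|u v]; first by rewrite inE => /andP[].
rewrite !inE => /andP[uS uz] uv vz; rewrite vz andbT.
by apply: contra uS => vS; apply: Scl uz; [exact: vS|rewrite e_sym].
Qed.

Hypothesis noSIL : forall v z K, ~ SIL v z K.

(** If v is in S, use instead the complement T of S outside the star of z: conjugating by [gen z] on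
    S or on T differs by an inner automorphism. *)
Lemma partial_conj_one_sided z S F f v : star_closed z S -> is_partial_conj z S F ->
  special_aut f -> v != z -> one_sided f v -> one_sided (f \o F) v.
Proof.
move=> Scl FP fP vz f1; have [vS|vS] := boolP (v \in S); last first.
  exact: (partial_conj_one_sided_notin Scl FP).
have Tcl := star_closedC Scl; set T := [set _ | _]%SET in Tcl.
have [F' F'P] := partial_conj_exists Tcl.
have f'1 : one_sided (f \o F') v.
  by apply: (partial_conj_one_sided_notin Tcl F'P) => //; rewrite inE vS.
apply: (one_sided_conj (k := f (gen z))) f'1.
have [_ fM _] := fP; have [FM _] := FP; have [F'M _] := F'P.
apply: morph_gen_eq => [x y|x y|u] /=; first by rewrite FM fM.
  by rewrite F'M fM conjMg.
have [uS|uS] := boolP (u \in S).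
  rewrite (partial_conj_in FP) // (partial_conj_notin F'P) //.
  by rewrite inE uS.
rewrite (partial_conj_notin FP) //.
have [uz|uz] := boolP (u \in star e z).
  have uT : u \notin T by rewrite inE uz andbF.
  by rewrite (partial_conj_notin F'P f uT) commute_conj //; exact: special_aut_commute.
have uT : u \in T by rewrite inE uS uz.
by rewrite (partial_conj_in F'P fP uT) special_conjK.
Qed.

(** S consists of the vertices whose walls lie beyond that of z as seen from 1; the partial
    conjugation reflects them to the near side. *)
Lemma partial_conj_straighten z f : special_aut f -> exists S F,
  [/\ star_closed z S, is_partial_conj z S F & one_sided (f \o F) z].
Proof.
move=> fP.
pose far u := exists g, f (gen u) ^ g = gen u /\ sep g (f (gen z)).
pose S := [set u | (u \notin star e z) && `[< far u >]]%SET.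
have Scl : star_closed z S.
  split=> [u|u v]; first by rewrite inE => /andP[].
  rewrite !inE => /andP[uz /asboolP[g [fg sg]]] uv vz; rewrite vz; apply/asboolP.
  have [_ _ /(_ v)[h fh]] := fP; exists h; split=> //.
  rewrite -(adjacent_side fP _ _ _ fg fh) // inE ?negb_or //.
  by rewrite uv orbT.
have [F FP] := partial_conj_exists Scl; exists S, F; split=> //.
exists false => u g uz /=; rewrite (partial_conj_center Scl FP).
have [uS|uS] := boolP (u \in S); last first.
  rewrite (partial_conj_notin FP) // => fg; apply: contraNF uS => sg.
  by rewrite inE uz; apply/asboolP; exists g.
move=> /(partial_conj_chamber FP fP uS) fg.
move: (uS); rewrite inE => /andP[_ /asboolP[h [fh]]].
rewrite (adjacent_side fP uz uz _ fh fg) ?inE ?eqxx //.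
rewrite sepM special_aut_refl // commute_conj; last exact: commute_refl.
by case: sep.
Qed.

(** * Finiteness of the outer automorphism group *)

(** One fixed map for each z and S, so that there are finitely many composites; [id] stands in when
    S admits none. *)
Definition partial_conj z S : W -> W :=
  if pselect (exists F, is_partial_conj z S F) is left F then projT1 (cid F) else id.

Lemma partial_conjP z S F :
  is_partial_conj z S F -> is_partial_conj z S (partial_conj z S).
Proof.
move=> FP; rewrite /partial_conj; case: pselect => [ex|[]]; last by exists F.
exact: projT2 (cid ex).
Qed.

Fixpoint partial_conjs (s : seq V) : set (W -> W) :=
  if s is z :: s' then [set F \o partial_conj z S | F in partial_conjs s' & S in setT]
  else [set id].

Lemma finite_partial_conjs s : finite_set (partial_conjs s).
Proof.
elim: s => [|z s IHs] /=; first exact: finite_set1.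
exact: finite_image2.
Qed.

Lemma straighten s f : special_aut f -> exists F, [/\ partial_conjs s F,
  special_aut (f \o F) & forall v, v \in s -> one_sided (f \o F) v].
Proof.
move=> fP; elim: s => [|z s [F [Fs fFP Fv]]]; first by exists id.
have [S [G [Scl GP Gz]]] := partial_conj_straighten z fFP.
have HP := partial_conjP GP; set H := partial_conj z S in HP.
have GH : G = H.
  by apply/funext/morph_gen_eq => [||u]; rewrite ?GP.2 ?HP.2 //; [exact: GP.1|exact: HP.1].
exists (F \o H); split.
- by exists F => //; exists S.
- exact: (special_aut_partial_conj Scl HP fFP).
move=> v; rewrite inE; have [->|vz] /= := eqVneq v z; first by rewrite -GH.
by move=> /Fv; exact: (partial_conj_one_sided Scl HP fFP).
Qed.

(** The right-hand side mentions F only, so finitely many F leave finitely many cosets of inner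
    automorphisms. *)
Lemma special_aut_coset f F : special_aut f -> bijective F ->
    (exists g0, forall x, f (F x) = g0 * x * g0^-1) ->
  [set f \o i | i in Inn W] = [set h : W -> W | Inn W (h \o F)].
Proof.
move=> fP [F' FK F'K] [g0 fF]; have [fB fM _] := fP.
have fE x : f x = g0 * F' x * g0^-1 by rewrite -fF F'K.
have fJ g x : f (g * x * g^-1) = f g * f x * (f g)^-1.
  rewrite !fM; congr (_ * _); apply/esym/mulg1_eq.
  by rewrite -fM mulgV special_aut1.
apply/seteqP; split=> [_ [_ [g _ <-] <-]|h [g _ hF]] /=.
  exists (f g * g0) => //; apply/funext => x /=.
  by rewrite fJ fF invgM !mulgA.
have [f' _ f'K] := fB; pose k := f' (g * g0^-1).
exists (fun x => k * x * k^-1); first by exists k.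
apply/funext => x /=; rewrite fJ f'K fE -[in RHS](F'K x).
have := congr1 (fun H => H (F' x)) hF => /= <-.
by rewrite !invgM !invgK !mulgA !mulgVK.
Qed.

Theorem out_finite (Fin : set W) : finite_set Fin ->
  (forall x, x * x = 1 -> exists g, Fin (x ^ g)) -> finite_set (Out W).
Proof.
move=> /finite_seqP[s sE] FinP.
(* The type records the conjugacy class of each involution f (gen v). Two automorphisms of the same
   type differ by one that sends every generator to a conjugate; [rep t] is a fixed automorphism of
   type t. *)
pose ty (f : W -> W) (t : {ffun V -> 'I_(size s)}) :=
  forall v, exists g, f (gen v) ^ g = nth 1 s (t v).
pose rep t := if pselect (exists f, Aut W f /\ ty f t) is left p
  then projT1 (cid p) else id.
pose cosets t F := [set rep t \o h | h in [set h : W -> W | Inn W (h \o F)]].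
apply: (@sub_finite_set _ _ [set cosets t F | t in setT & F in partial_conjs (enum V)]);
  last by apply: finite_image2 => //; exact: finite_partial_conjs.
move=> _ [f [fB fM] <-].
have m1 (h : W -> W) : {morph h : x y / x * y} -> h 1 = 1.
  by move=> hM; apply: (@mulgI _ (h 1)); rewrite -hM !mulg1.
have mV (h : W -> W) x : {morph h : x y / x * y} -> h x^-1 = (h x)^-1.
  by move=> hM; apply/esym/mulg1_eq; rewrite -hM mulgV m1.
have [t ft] : exists t, ty f t.
  have /choice[t tP] : forall v, exists j : 'I_(size s), exists g, f (gen v) ^ g = nth 1 s j.
    move=> v; have [g] : exists g, Fin (f (gen v) ^ g).
      by apply: FinP; rewrite -fM racg_gen_square m1.
    rewrite sE /= => fgs; have fgs' := fgs; rewrite -index_mem in fgs'.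
    by exists (Ordinal fgs'), g; rewrite /= nth_index.
  by exists (finfun t) => v; rewrite ffunE.
have [[rB rM] rt] : Aut W (rep t) /\ ty (rep t) t.
  by rewrite /rep; case: pselect => [p|[]]; [exact: projT2 (cid p)|exists f].
have [r' rK r'K] := rB; pose h := r' \o f.
have r'M : {morph r' : x y / x * y}.
  by move=> x y; apply: (can_inj rK); rewrite rM !r'K.
have fE : f = rep t \o h by apply/funext => x; rewrite /h /= r'K.
have hP : special_aut h.
  split; first by apply: bij_comp => //; exists (rep t).
    by move=> x y; rewrite /h /= fM r'M.
  move=> v; have [g fg] := ft v; have [g' rg'] := rt v.
  exists (r' (g' * g^-1))^-1.
  have -> : h (gen v) = gen v ^ r' (g' * g^-1); last by rewrite conjgK.
  have rJ x y : rep t (x ^ y) = rep t x ^ rep t y by rewrite !conjgE !rM mV.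
  by apply: (can_inj rK); rewrite /h /= r'K rJ r'K conjgM rg' -fg conjgK.
have [F [Fs hFP hF1]] := straighten (enum V) hP.
exists t => //; exists F => //; rewrite /cosets -(special_aut_coset hP).
- apply/seteqP; split=> [_ [_ [i iI <-] <-]|_ [i iI <-]] /=.
    by exists i => //; rewrite fE.
  by exists (h \o i); [exists i|rewrite fE].
- have [h' hK _] : bijective h by case: hP.
  apply: (@eq_bij _ _ (h' \o (h \o F))) => [|x /=]; last by rewrite hK.
  apply: bij_comp; last by case: hFP.
  by exists h => //; case: hP => -[h'' h1 h2] _ _ x; rewrite -{1}[x]h2 hK h2.
by apply: (one_sided_inner hFP) => v; apply: hF1; rewrite mem_enum.
Qed.

End Automorphisms.

(** * The splitting given by a separating intersection of links *)

Section SIL_Splitting.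
Local Open Scope group_scope.
Variables (V : finType) (e : rel V).
Hypotheses (e_sym : symmetric e) (e_irr : irreflexive e).
Local Notation W := (racg e).
Local Notation gen := (racg_gen e).
Variables (v w : V) (K : {set V}).
Hypothesis vwK : SIL e v w K.
Implicit Types (b c d g h x y : W) (k s : V).

Definition links := [pred z | e v z && e w z].

(* W splits as an amalgam over the special subgroup of links, one factor
   being generated by links and K; side is the set of the elements whose
   normal form starts in that factor. *)
Definition side g := exists c k,
  [/\ special links c, k \in K & sep g (gen k ^ c^-1)].

Lemma links_notin k : k \in links -> k \notin K.
Proof.
by move=> kl; have [_ _ _ _ KP] := vwK; apply/negP => /KP-/(_ k)[/negP].
Qed.

Lemma special_links_notin c : special links c -> special [predC K] c.
Proof.
by move=> [u ul <-]; exists u => //; apply: sub_all ul => k /links_notin.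
Qed.

Lemma star_in_K k s : k \in K -> s \in star e k -> s \in [predU K & links].
Proof.
move=> kK; rewrite !inE => /orP[/eqP->|ks]; first by rewrite kK.
by have [_ _ _ _ /(_ k s kK)[_ /(_ ks)[->|->]]] := vwK; rewrite ?orbT.
Qed.

Lemma special_sep_type (T : {pred V}) g k h :
  special T g -> sep g (gen k ^ h) -> k \in T.
Proof.
move=> Tg /(special_sep Tg)[s [y [sT _ ksy]]].
suff -> : k = s by [].
by apply: (@gen_conj _ e k s (h * y^-1)); rewrite conjgM ksy conjgK.
Qed.

Lemma side_notin b : special [predC K] b -> ~ side b.
Proof. by move=> Bb [c [k [_ kK /(special_sep_type Bb)]]]; rewrite inE kK. Qed.

Lemma side_linksM c g : special links c -> side (c * g) -> side g.
Proof.
move=> Cc [d [k [Cd kK sg]]]; exists (c^-1 * d), k; split => //.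
  by apply: specialM => //; exact: specialV.
have /negbTE sc : ~~ sep c (gen k ^ d^-1).
  by apply/negP => /(special_sep_type Cc) /links_notin; rewrite kK.
by move: sg; rewrite sepM sc invgM invgK -conjgM.
Qed.

Lemma split_notin (T : {pred V}) u : ~~ all [in T] u ->
  exists u1 s u2, [/\ u = u1 ++ s :: u2, all [in T] u1 & s \notin T].
Proof.
elim: u => [//|s u IHu] /=; have [sT /=|sT _] := boolP (s \in T); last first.
  by exists [::], s, u.
move=> /IHu[u1 [y [u2 [-> u1T yT]]]]; exists (s :: u1), y, u2; split=> //=.
by rewrite sT.
Qed.

Lemma factor_notin_side x : special [predU K & links] x -> ~ side x ->
  special links x.
Proof.
move=> Ax nx; have [u ux su] := len_min_word x.
have [ul|/split_notin[u1 [s [u2 [uE u1l sl]]]]] := boolP (all [in links] u).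
  by exists u.
have C1 : special links (word e u1) by exists u1.
have sx : sep x (gen s ^ (word e u1)^-1).
  rewrite -ux uE -cat_rcons; apply: minimal_sep.
    by rewrite cat_rcons -uE /minimal ux.
  rewrite word_rcons sepM conjgKV sep_gen eqxx addbT.
  by apply/negP => /(special_sep_type C1); rewrite (negbTE sl).
have := special_sep_type Ax sx; rewrite inE (negbTE sl) orbF => sK.
by case: nx; exists (word e u1), s.
Qed.

(** The edge crosses the wall of some c k c^-1, so c^-1 g centralizes k and lies in the factor
    generated by K and the links. *)
Lemma side_edge g s : ~ side g -> side (g * gen s) -> special links g.
Proof.
move=> ng [c [k [Cc kK sgs]]]; have nsg : ~~ sep g (gen k ^ c^-1).
  by apply/negP => sg; apply: ng; exists c, k.
move: sgs; rewrite sepM (negbTE nsg) sep_gen /= -conjgM => /eqP ks.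
have sk := gen_conj ks; rewrite -{s}sk in ks.
have Ax : special (star e k) (c^-1 * g).
  by apply: (centralizer_gen e_sym); exact/commute_sym/conj_commute.
rewrite -[g](mulVKg c); apply: specialM => //; apply: factor_notin_side.
  have [u uk <-] := Ax; exists u => //; apply: sub_all uk => s.
  exact: star_in_K.
by move=> /side_linksM sg; apply: ng; apply: sg; exact: specialV.
Qed.

Lemma side_cross g h : ~ side g -> side h ->
  exists2 c, special links c & (len (h^-1 * c) <= len (g^-1 * h))%N.
Proof.
have [u uE <-] := len_min_word (g^-1 * h).
have {h uE} -> : h = g * word e u by rewrite uE mulVKg.
elim: u g => [|s u IHu] g ng; first by rewrite word_nil mulg1.
move=> sg; have [sgs|nsgs] := pselect (side (g * gen s)).
  exists g; first exact: side_edge sgs.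
  by rewrite invgM mulgVK lenV len_word.
move: sg; rewrite word_cons mulgA => /(IHu _ nsgs)[c Cc lec].
by exists c => //; apply: leq_trans lec _.
Qed.

(** If the last letter s of b is in the star of k, it is a link and can be stripped. Otherwise b^-1
    x would be beyond the disjoint walls of s and k. *)
Lemma coset_wall x : (forall s h, s \in [predC K] -> special [predC K] h ->
    ~~ sep x (gen s ^ h)) ->
  forall k b, k \in K -> special [predC K] b -> sep x (gen k ^ b^-1) -> special links b.
Proof.
move=> nx k b kK; elim/len_ind: b => b IHb Bb sx.
have [->|] := eqVneq b 1; first exact: special1.
rewrite -eqg_inv invg1 => /sep_first[s sbs].
have Bb' := specialV Bb.
have sB : s \in [predC K].
  by move: sbs; rewrite -[gen s]conjg1; exact: special_sep_type.
have bE : b = (gen s * b^-1)^-1 * gen s.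
  by rewrite invgM invgK genV -mulgA racg_gen_square mulg1.
have [sk|nsk] := boolP (s \in star e k).
  rewrite bE; apply: specialM; last first.
    apply: special_gen; move: (star_in_K kK sk) sB; rewrite !inE.
    by case: (s \in K).
  apply: IHb.
  - by rewrite lenV -[X in (_ < X)%N]lenV; exact: sep_len.
  - by apply/specialV/specialM => //; exact: special_gen.
  by rewrite invgK conjgM [gen k ^ gen s]commute_conj //; exact: star_commute.
have := star_disjoint e_sym nsk (g := b^-1 * x).
rewrite !sepM sbs sx (negbTE (nx _ _ sB Bb')).
have /negbTE -> : ~~ sep b^-1 (gen k).
  by rewrite -[gen k]conjg1; apply/negP => /(special_sep_type Bb'); rewrite inE kK.
by move=> /(_ isT).
Qed.

(** Write g = d x with x shortest in its coset. That g is in the side puts d in the special subgroup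
    of the links, and that b^-1 g is puts b^-1 d there. *)
Lemma side_disjoint b g : special [predC K] b -> side g -> side (b^-1 * g) ->
  special links b.
Proof.
move=> Bb; have [d [x [Bd -> nx]]] := special_coset [predC K] g.
have side_coset d' : special [predC K] d' -> side (d' * x) -> special links d'.
  move=> Bd' [c [k [Cc kK]]]; rewrite sepM.
  have /negbTE -> /= : ~~ sep d' (gen k ^ c^-1).
    by apply/negP => /(special_sep_type Bd'); rewrite inE kK.
  have Bc := special_links_notin Cc.
  rewrite -conjgM -[c^-1 * d']invgK invgM invgK => /(coset_wall nx kK) Cdc.
  have {}Cdc : special links (d'^-1 * c).
    by apply: Cdc; apply: specialM => //; exact: specialV.
  rewrite -[d']invgK; apply: specialV; rewrite -[d'^-1](mulgK c).
  by apply: specialM => //; exact: specialV.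
move=> /side_coset Cd; rewrite mulgA => /side_coset Cbd.
rewrite -[b]invgK; apply: specialV; rewrite -[b^-1](mulgK d).
apply: specialM; first by apply: Cbd; apply: specialM => //; exact: specialV.
by apply: specialV; exact: Cd.
Qed.

(** * Translates of the side by powers of v w *)

Section Translations.

Lemma links_commute c : special links c ->
  commute (gen v) c /\ commute (gen w) c.
Proof.
move=> Cc; split; apply: special_commute Cc => s; rewrite inE => /andP[vs ws];
  exact: racg_gen_comm.
Qed.

Definition trans := gen v * gen w.

Lemma trans_commute c n : special links c -> commute c (trans ^+ n).
Proof.
move=> /links_commute[vc wc]; apply: commuteX; apply: commuteM; exact: commute_sym.
Qed.

Lemma trans_special n : special [predC K] (trans ^+ n).
Proof.
have [_ _ _ [vK wK] _] := vwK; apply: specialX.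
by apply: specialM; apply: special_gen; rewrite inE.
Qed.

Lemma transJ n : gen v * trans ^+ n * gen v = trans ^- n.
Proof.
rewrite -{1}[gen v]genV -mulgA -conjgE conjXg -expVgn; congr (_ ^+ n).
by rewrite /trans conjgE invgM !genV -mulgA genK.
Qed.

Lemma dihedral_pos_powers (a b : V) n (m : int) : a != b -> ~~ e a b -> ~~ e b a ->
  dihedral_pos a b ((gen a * gen b) ^+ n) m = (m - (n.*2)%:Z)%R.
Proof.
move=> ab nab nba; elim: n => [|n IHn].
  by rewrite expg0 dihedral_pos1 // subr0.
rewrite expgS -mulgA !dihedral_posM // IHn !dihedral_pos_gen //.
by rewrite /dihedral_act !eqxx [b == a]eq_sym (negbTE ab); lia.
Qed.

Lemma dihedral_pos_special (a b : V) (T : {pred V}) c (m : int) :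
  a != b -> ~~ e a b -> ~~ e b a -> a \notin T -> b \notin T ->
  special T c -> dihedral_pos a b c m = m.
Proof.
move=> ab nab nba aT bT; elim/special_ind => [|s g sT _ IHg]; first exact: dihedral_pos1.
rewrite dihedral_posM // IHg dihedral_pos_gen // /dihedral_act.
by case: eqP sT aT => [-> ->//|_ sT _]; case: eqP sT bT => [-> ->|].
Qed.

Lemma trans_links n : special links (trans ^+ n) -> n = 0.
Proof.
have [vw nvw _ _ _] := vwK; have nwv : ~~ e w v by rewrite e_sym.
move=> /(@dihedral_pos_special v w links _ 0%R vw nvw nwv).
rewrite !inE !e_irr andbF /= dihedral_pos_powers // => /(_ isT isT); lia.
Qed.

Lemma trans_inj : injective (fun n => trans ^+ n).
Proof.
have [vw nvw _ _ _] := vwK; have nwv : ~~ e w v by rewrite e_sym.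
move=> m n /(congr1 (fun g : W => dihedral_pos v w g 0%R)).
by rewrite !dihedral_pos_powers //; lia.
Qed.

Lemma trans_side_disjoint m n g : m != n ->
  side (trans ^- m * g) -> ~ side (trans ^- n * g).
Proof.
wlog mn : m n / (m <= n)%N.
  move=> IH nmn; case: (leqP m n) => [/IH/(_ nmn)//|/ltnW nm] sm sn.
  by move: sn sm; apply: IH; rewrite // eq_sym.
move=> nmn sm sn; have := @side_disjoint (trans ^+ (n - m)) _ (trans_special _) sm.
rewrite mulgA -invgM -expgnDr subnKC // => /(_ sn) /trans_links /eqP.
by rewrite subn_eq0 leqNgt ltn_neqAle nmn mn.
Qed.

Section Transverse.
Variable u : V.
Hypothesis uK : u \in K.

Lemma transverse_nonadjacent : [/\ u != v, ~~ e u v & ~~ e v u].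
Proof.
have [_ _ _ [vK wK] KP] := vwK.
have uv : ~~ e u v.
  apply/negP => euv; have [_ /(_ euv)[|]] := KP u v uK; first by rewrite (negbTE vK).
  by rewrite e_irr.
by split; [apply: contraNneq vK => <-| |rewrite e_sym].
Qed.

Definition transverse := gen u * gen v.

Lemma transverse_side n : side (transverse ^+ n.+1).
Proof.
have [uv nuv nvu] := transverse_nonadjacent.
exists 1, u; split=> //; first exact: special1.
rewrite invg1 conjg1; elim: n => [|n IHn]; rewrite expgS -mulgA sep_genM_gen.
  apply: (sep_disjoint (a := v)); rewrite // 1?eq_sym // expg0 mulg1.
  exact: sep_gen_gen.
apply: (sep_disjoint (a := v)); rewrite // 1?eq_sym // sep_genM_gen.
exact: sep_disjoint IHn.
Qed.

(** The links act trivially through the dihedral quotient on u and v, where (u v) ^ n moves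
    positions by 2 n. *)
Lemma transverse_len n c : special links c -> (n <= len (transverse ^- n * c))%N.
Proof.
have [uv nuv nvu] := transverse_nonadjacent => Cc.
have uL : u \notin links by apply/negP => /links_notin; rewrite uK.
have vL : v \notin links by rewrite inE e_irr.
rewrite -lenV invgM invgK; apply: leq_trans (dihedral_pos_len uv nuv nvu _).
rewrite dihedral_posM // dihedral_pos_powers //.
rewrite (dihedral_pos_special _ uv nuv nvu uL vL) //; last exact: specialV.
lia.
Qed.

Lemma transverse_inj : injective (fun n => transverse ^+ n).
Proof.
have [uv nuv nvu] := transverse_nonadjacent.
move=> m n /(congr1 (fun g : W => dihedral_pos u v g 0%R)).
by rewrite !dihedral_pos_powers //; lia.
Qed.

End Transverse.
End Translations.
End SIL_Splitting.

(** * CAT(0) geometry *)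

Section CAT0_Geometry.
Local Open Scope ring_scope.
Variables (R : realType) (X : metricType R).
Implicit Types (x y z p q : X) (c : R -> X) (s t l : R).

Lemma edist_scale l (x y : R * R) : 0 <= l ->
  edist (l * x.1, l * x.2) (l * y.1, l * y.2) = l * edist x y.
Proof.
move=> l0; rewrite /edist /= -!mulrBr !exprMn -mulrDr.
by rewrite sqrtrM ?sqr_ge0 // sqrtr_sqr ger0_norm.
Qed.

Lemma edist_sym (x y : R * R) : edist x y = edist y x.
Proof. by rewrite /edist -sqrrN opprB -[X in _ + X]sqrrN opprB. Qed.

Lemma edist_axis (s t : R) : edist (s, 0) (t, 0) = `|s - t|.
Proof. by rewrite /edist /= subr0 expr0n addr0 sqrtr_sqr. Qed.

Lemma comparison_triangle (a b d : R) : 0 <= a -> 0 <= b -> 0 <= d ->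
    a <= b + d -> b <= a + d -> d <= a + b ->
  exists z : R * R, edist (0, 0) z = b /\ edist (a, 0) z = d.
Proof.
move=> a0 b0 d0 h1 h2 h3; have [a_eq0|a_neq0] := eqVneq a 0.
  exists (b, 0); rewrite !edist_axis a_eq0 !sub0r !normrN ger0_norm //.
  by split=> //; lra.
(* The abscissa of the apex, by the law of cosines. *)
pose u := (a ^+ 2 + b ^+ 2 - d ^+ 2) / (2 * a).
have au : 2 * a * u = a ^+ 2 + b ^+ 2 - d ^+ 2
    by rewrite /u mulrC divfK // mulf_neq0 // pnatr_eq0.
have ap : 0 < a by rewrite lt_neqAle eq_sym a_neq0.
have ub : u ^+ 2 <= b ^+ 2.
  rewrite -(@ler_pM2l _ ((2 * a) ^+ 2)) ?exprn_gt0 ?mulr_gt0 // -exprMn au -exprMn.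
  have h4 : (a - b) ^+ 2 <= d ^+ 2 by nra.
  have h5 : d ^+ 2 <= (a + b) ^+ 2 by nra.
  rewrite -subr_ge0 subr_sqr mulr_ge0 //; nra.
exists (u, Num.sqrt (b ^+ 2 - u ^+ 2)); rewrite /edist /= !sub0r !sqrrN.
rewrite !sqr_sqrtr ?subr_ge0 //; split.
  by rewrite addrC subrK sqrtr_sqr ger0_norm.
have -> : (a - u) ^+ 2 + (b ^+ 2 - u ^+ 2) = d ^+ 2 by nra.
by rewrite sqrtr_sqr ger0_norm.
Qed.

Lemma geodesic_rev c x y : geodesic c x y -> geodesic (fun s => c (mdist x y - s)) y x.
Proof.
move=> [c0 c1 ci]; rewrite /geodesic (metric_sym y x); split; rewrite ?subr0 ?subrr //.
move=> s t; rewrite !in_itv /= => /andP[s0 s1] /andP[t0 t1].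
rewrite ci ?in_itv /= ?subr_ge0 ?s1 ?t1 ?lerBlDr ?lerDl //.
by rewrite distrC; congr (`| _ |); lra.
Qed.

Lemma geodesic_dist0 c x y s : geodesic c x y -> s \in `[0, mdist x y] ->
  mdist x (c s) = s.
Proof.
move=> [c0 _ ci] sI; rewrite -[in LHS]c0 ci // ?sub0r ?normrN.
  by move: sI; rewrite in_itv /= => /andP[s0 _]; rewrite ger0_norm.
by rewrite in_itv /= lexx mdist_ge0.
Qed.

Lemma geodesic_dist1 c x y s : geodesic c x y -> s \in `[0, mdist x y] ->
  mdist (c s) y = mdist x y - s.
Proof.
move=> [_ c1 ci] sI; rewrite -[in LHS]c1 ci //; last first.
  by rewrite in_itv /= lexx mdist_ge0.
by move: sI; rewrite in_itv /= distrC => /andP[_ s1]; rewrite ger0_norm // subr_ge0.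
Qed.

Lemma scale_itv l (d : R) : 0 <= l <= 1 -> 0 <= d -> l * d \in `[0, d].
Proof.
by move=> /andP[l0 l1] d0; rewrite in_itv /= mulr_ge0 //= ler_piMl.
Qed.

Hypothesis X0 : CAT0 X.

Lemma cat0_geodesic x y : exists c, geodesic c x y.
Proof. by case: X0. Qed.

Lemma cat0_fan c c' x y z l : geodesic c x y -> geodesic c' x z -> 0 <= l <= 1 ->
  mdist (c (l * mdist x y)) (c' (l * mdist x z)) <= l * mdist y z.
Proof.
move=> cG c'G l01; have [l0 l1] := andP l01; have [geo tri] := X0.
have [c2 c2G] := geo y z.
have [[u v] [z1 z2]] := @comparison_triangle (mdist x y) (mdist x z) (mdist y z)
  (mdist_ge0 _ _) (mdist_ge0 _ _) (mdist_ge0 _ _)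
  ltac:(by rewrite [mdist y z]metric_sym; exact: metric_triangle)
  (metric_triangle _ _ _)
  ltac:(by rewrite [mdist x y]metric_sym; exact: metric_triangle).
pose S (c : R -> X) (x y : X) := c @` `[0, mdist x y].
have segS c0 x0 y0 : geodesic c0 x0 y0 -> geodesic_segment (S c0 x0 y0) x0 y0.
  by move=> G; exists c0.
have := tri x y z _ _ _ (0, 0) (mdist x y, 0) (u, v) (segS _ _ _ cG) (segS _ _ _ c2G)
  (segS _ _ _ (geodesic_rev c'G)).
rewrite edist_axis sub0r normrN ger0_norm ?mdist_ge0 // => /(_ erefl z2).
rewrite edist_sym z1 (metric_sym z x) => /(_ erefl) /=.
have aI := scale_itv l01 (mdist_ge0 x y); have bI := scale_itv l01 (mdist_ge0 x z).
move=> /(_ (c (l * mdist x y)) (c' (l * mdist x z))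
  (l * mdist x y, l * 0) (l * u, l * v)) h.
apply: le_trans (h _ _) _.
- apply: Or31; split; first by exists (l * mdist x y).
    by exists l; rewrite //= !mulr0 !add0r.
  rewrite mulr0 edist_axis sub0r normrN ger0_norm ?mulr_ge0 ?mdist_ge0 //.
  by rewrite (geodesic_dist0 cG).
- apply: Or33; split.
  + exists (mdist x z - l * mdist x z); last by rewrite subKr.
    move: bI; rewrite /= !in_itv /= (metric_sym z x) => /andP[b0 b1].
    by rewrite subr_ge0 b1 lerBlDr lerDl.
  + exists (1 - l); last by rewrite /= !mulr0 !addr0 subKr.
    by rewrite /= in_itv /= subr_ge0 l1 lerBlDr lerDl.
  have [_ c'1 c'i] := c'G.
  rewrite [mdist z _]metric_sym (geodesic_dist1 c'G) //.
  have -> : (l * u, l * v) = (u - (1 - l) * u, v - (1 - l) * v).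
    by congr (_, _); lra.
  rewrite /edist /= !subKr !exprMn -mulrDr sqrtrM ?sqr_ge0 // sqrtr_sqr.
  rewrite ger0_norm ?subr_ge0 // mulrBl mul1r; congr (_ - _ * _);
    by rewrite -z1 /edist /= !sub0r !sqrrN.
by rewrite -z2 -edist_scale.
Qed.

Lemma cat0_geodesic_uniq c c' x y s : geodesic c x y -> geodesic c' x y ->
  s \in `[0, mdist x y] -> c s = c' s.
Proof.
move=> cG c'G; have [d0|d0] := eqVneq (mdist x y) 0.
  rewrite d0 in_itv /= -eq_le => /eqP <-.
  by case: cG => -> _ _; case: c'G => -> _ _.
have dp : 0 < mdist x y by rewrite lt_neqAle eq_sym d0 mdist_ge0.
rewrite in_itv /= => /andP[s0 s1]; apply: mdist_positivity.
have := cat0_fan (l := s / mdist x y) cG c'G.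
rewrite divfK // mdistxx mulr0 divr_ge0 ?mdist_ge0 // ler_pdivrMr // mul1r s1.
by move=> /(_ isT) h; apply/eqP; rewrite eq_le h mdist_ge0.
Qed.

(** The diagonal from x to y' splits the quadrilateral into two fans. *)
Lemma cat0_convex c c' x y x' y' l : geodesic c x y -> geodesic c' x' y' -> 0 <= l <= 1 ->
  mdist (c (l * mdist x y)) (c' (l * mdist x' y')) <=
  (1 - l) * mdist x x' + l * mdist y y'.
Proof.
move=> cG c'G l01; have [d dG] := cat0_geodesic x y'.
have := cat0_fan cG dG l01.
have l01' : 0 <= 1 - l <= 1 by move: l01; lra.
have := cat0_fan (geodesic_rev dG) (geodesic_rev c'G) l01'.
have E x0 y0 : mdist x0 y0 - (1 - l) * mdist y0 x0 = l * mdist x0 y0.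
  by rewrite (metric_sym y0 x0); lra.
rewrite !E => h1 h2; apply: le_trans (metric_triangle _ (d (l * mdist x y')) _) _.
by rewrite [leRHS]addrC; exact: lerD.
Qed.

(** The comparison triangle is degenerate: p and the point of c at the same distance from x have the
    same comparison point. *)
Lemma cat0_between c x y p : geodesic c x y -> mdist x p + mdist p y = mdist x y ->
  c (mdist x p) = p.
Proof.
move=> cG xpy; have [geo tri] := X0.
have [c2 c2G] := geo y p; have [c3 c3G] := geo p x.
have px0 := mdist_ge0 x p; have py0 := mdist_ge0 p y.
have := tri x y p _ _ _ (0, 0) (mdist x y, 0) (mdist x p, 0)
  (ex_intro2 _ _ c cG erefl) (ex_intro2 _ _ c2 c2G erefl) (ex_intro2 _ _ c3 c3G erefl).
rewrite !edist_axis sub0r normrN subr0 !ger0_norm ?mdist_ge0 //; last first.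
  by rewrite -xpy; lra.
have yp : mdist x y - mdist x p = mdist y p by rewrite (metric_sym y p) -xpy; lra.
move=> /(_ erefl yp (metric_sym _ _)) /= h.
have pI : mdist x p \in `[0, mdist x y].
  by rewrite in_itv /=; lra.
apply: mdist_positivity; apply/eqP; rewrite eq_le mdist_ge0 andbT.
apply: le_trans (h (c (mdist x p)) p (mdist x p, 0) (mdist x p, 0) _ _) _.
- apply: Or31; split; first by exists (mdist x p).
    exists (mdist x p / mdist x y).
      rewrite /= in_itv /= divr_ge0 ?mdist_ge0 //=.
      have [->|d0] := eqVneq (mdist x y) 0; first by rewrite invr0 mulr0.
      rewrite ler_pdivrMr ?mul1r; first by rewrite -xpy; lra.
      by rewrite lt_neqAle eq_sym d0 mdist_ge0.
    rewrite /= !mulr0 !add0r; have [d0|d0] := eqVneq (mdist x y) 0; last by rewrite divfK.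
    by rewrite d0 mulr0; congr (_, _); lra.
  by rewrite edist_axis sub0r normrN ger0_norm // (geodesic_dist0 cG).
- apply: Or33; split.
  + by exists 0; [rewrite /= in_itv /= lexx mdist_ge0|case: c3G].
  + by exists 0; rewrite ?mul0r ?subr0 ?mul1r ?addr0 //= in_itv /= lexx ler01.
  by rewrite edist_axis subrr normr0 mdistxx.
by rewrite edist_axis subrr normr0.
Qed.

End CAT0_Geometry.

(** * Geometric actions *)

Section Metric.
Local Open Scope ring_scope.
Variables (R : realType) (X : metricType R).

Lemma nbhs_mdist (x : X) (eps : R) : 0 < eps -> nbhs x [set y | mdist x y < eps].
Proof. by move=> e0; rewrite -ballEmdist; exact: nbhsx_ballx. Qed.

Lemma invS_lt (eps : R) : 0 < eps -> exists n : nat, n.+1%:R^-1 < eps.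
Proof.
move=> e0; exists (Num.truncn eps^-1).
rewrite invf_plt ?posrE ?ltr0n //; exact: truncnS_gt.
Qed.

Lemma compact_sequence (x : X) (y : nat -> X) :
    (forall n, mdist x (y n) < n.+1%:R^-1) ->
  compact ([set x] `|` range y).
Proof.
move=> yx F FF FS; have [Fx|nFx] := pselect (cluster F x).
  by exists x; split => //; left.
move/existsNP: nFx => [A /existsNP[B /not_implyP[FA /not_implyP[]]]].
move=> /nbhs_ballP[eps /= e0 xB] AB0.
have [N Ne] := invS_lt e0.
have FN : F (y @` `I_N).
  apply: filterS (filterI FA FS) => z [Az [zx|[n _ yz]]].
    by case: AB0; exists x; split; [rewrite -zx|apply: xB; exact: ballxx].
  exists n => //=; rewrite ltnNge; apply/negP => Nn; apply: AB0; exists z.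
  split=> //; apply: xB; rewrite ballEmdist /= -yz; apply: lt_trans (yx n) _.
  by apply: le_lt_trans Ne; rewrite lef_pV2 ?posrE ?ltr0n // ler_nat.
have [|z [[n _ yz] zF]] := @finite_compact X (y @` `I_N) _ F FF FN.
  exact: finite_image.
by exists z; split => //; right; exists n.
Qed.

End Metric.

Section Action.
Local Open Scope ring_scope.
Variables (R : realType) (V : finType) (e : rel V) (X : metricType R).
Local Notation W := (racg e).
Variable act : W -> X -> X.
Hypotheses (X0 : CAT0 X) (actP : geometric_action act).
Implicit Types (x y z : X) (g h : W).

Lemma act_dist g x y : mdist (act g x) (act g y) = mdist x y.
Proof. exact: (act_isometry actP). Qed.

Lemma actKV g x : act g (act g^-1%g x) = x.
Proof. by rewrite -(actM actP) mulgV (act1 actP). Qed.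

Lemma act_distV g x y : mdist (act g^-1%g x) y = mdist x (act g y).
Proof. by rewrite -(act_dist g) actKV. Qed.

Lemma act_continuous g : continuous (act g).
Proof.
move=> x A /nbhs_ballP[eps /= e0 xA]; apply/nbhs_ballP; exists eps => //= y.
by rewrite ballEmdist /= => xy; apply: xA; rewrite ballEmdist /= act_dist.
Qed.

Lemma act_geodesic g c x y :
  geodesic c x y -> geodesic (fun s => act g (c s)) (act g x) (act g y).
Proof.
move=> [c0 c1 ci]; rewrite /geodesic act_dist c0 c1; split=> // s t sI tI.
by rewrite act_dist ci.
Qed.

Section Compact_Fundamental_Domain.
Variable K : set X.
Hypothesis cK : compact K.

(** Otherwise points of translates of K by ever longer elements converge to x; together with K and x
    they form a compact set that violates proper discontinuity. *)
Lemma locally_finite x : exists eps : R, exists M : nat,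
  0 < eps /\ forall g k, K k -> mdist x (act g k) < eps -> (len g <= M)%N.
Proof.
apply: contrapT => nlf.
have /choice[f fP] : forall n : nat, exists gk : W * X,
    [/\ K gk.2, mdist x (act gk.1 gk.2) < n.+1%:R^-1 & (n < len gk.1)%N].
  move=> n; apply: contrapT => nex; apply: nlf; exists n.+1%:R^-1, n.
  split=> [|g k Kk xk]; first by rewrite invr_gt0 ltr0n.
  by rewrite leqNgt; apply/negP => ng; apply: nex; exists (g, k).
pose y n := act (f n).1 (f n).2.
have cK' : compact (K `|` ([set x] `|` range y)).
  by apply: compactU => //; apply: compact_sequence => n; case: (fP n).
have /finite_seqP[s sE] := act_properly_discontinuous actP cK'.
pose M := \max_(g <- s) len g.
have : (f M).1 \in s.
  have : [set` s] (f M).1; last by [].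
  rewrite -sE /=; exists (y M); split; last by right; right; exists M.
  by exists (f M).2 => //; left; case: (fP M).
case: (fP M) => _ _ ltM fs.
have := @leq_bigmax_seq _ _ xpredT (fun g : W => len g) _ fs isT.
by rewrite leqNgt ltM.
Qed.

Lemma uniformly_locally_finite : exists eps : R, exists M : nat, 0 < eps /\
  forall x g k, K x -> K k -> mdist x (act g k) < eps -> (len g <= M)%N.
Proof.
pose P (n : nat) x := forall g k, K k -> mdist x (act g k) < n.+1%:R^-1 -> (len g <= n)%N.
have [|N _ KP] := (compact_near_coveringP K).1 cK nat \oo P _.
  move=> x Kx; have [eps [M [e0 xM]]] := locally_finite x.
  have e2 : 0 < eps / 2 by rewrite divr_gt0.
  have [N Ne] := invS_lt e2.
  exists ([set y | mdist x y < eps / 2], [set n | (maxn N M <= n)%N]).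
    by split; [exact: nbhs_mdist|exact: nbhs_infty_ge].
  move=> [y n] [/= xy]; rewrite geq_max => /andP[Nn Mn] g k Kk yk.
  apply: leq_trans Mn; apply: (xM g k Kk).
  apply: le_lt_trans (metric_triangle _ y _) _; rewrite [ltRHS]splitr ltrD //.
  apply: lt_trans yk _; apply: le_lt_trans Ne.
  by rewrite lef_pV2 ?posrE ?ltr0n // ler_nat.
exists N.+1%:R^-1, N; split=> [|x g k Kx]; first by rewrite invr_gt0 ltr0n.
by apply: (KP N (leqnn _) x Kx).
Qed.

Lemma compact_bounded_dist x0 : exists D : R, forall k, K k -> mdist x0 k <= D.
Proof.
pose P (n : nat) x := mdist x0 x <= n%:R.
have [|N _ KP] := (compact_near_coveringP K).1 cK nat \oo P _.
  move=> x Kx.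
  exists ([set y | mdist x y < 1], [set n | ((Num.truncn (mdist x0 x)).+2 <= n)%N]).
    by split; [exact: nbhs_mdist|exact: nbhs_infty_ge].
  move=> [y n] [/= xy ltn]; rewrite /P; apply: le_trans (metric_triangle _ x _) _.
  have : (Num.truncn (mdist x0 x)).+2%:R <= n%:R :> R by rewrite ler_nat.
  have := truncnS_gt (mdist x0 x); rewrite -[(Num.truncn _).+2]addn1 natrD; lra.
by exists N%:R => k Kk; exact: (KP N (leqnn _) k Kk).
Qed.

End Compact_Fundamental_Domain.

Lemma cat0_point_between x y s : 0 <= s <= mdist x y ->
  exists z, mdist x z = s /\ mdist z y = mdist x y - s.
Proof.
move=> sI; have [c cG] := cat0_geodesic X0 x y; exists (c s).
have sI' : s \in `[0, mdist x y] by rewrite in_itv.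
by rewrite (geodesic_dist0 cG sI') (geodesic_dist1 cG sI').
Qed.

(* X is not assumed to be locally compact or complete.  Following a geodesic in
   steps of the uniform radius of local finiteness bounds both the word length of g
   (Milnor-Svarc) and the number of translates of K that meet a ball. *)
Lemma geometric_action_proper x0 : exists D A : R, [/\ 0 <= D, 0 <= A,
  forall x, exists g, mdist x (act g x0) <= D,
  forall g, (len g)%:R <= A * mdist x0 (act g x0) + A &
  forall r, compact [set x | mdist x0 x <= r]].
Proof.
have [K1 cK1 K1T] := act_cocompact actP.
pose K := [set x0] `|` K1.
have cK : compact K by apply: compactU => //; exact: compact_set1.
have KT x : exists g k, K k /\ x = act g k.
  have : setT x by []; rewrite -K1T => -[g _ [k Kk <-]].
  by exists g, k; split=> //; right.
have Kx0 : K x0 by left.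
have [D KD] := compact_bounded_dist cK x0.
have [eps [M [e0 lf]]] := uniformly_locally_finite cK.
pose d := eps / 2; have d0 : 0 < d by rewrite divr_gt0.
have chain n : forall x, mdist x0 x <= n%:R * d ->
    forall g k, K k -> x = act g k -> (len g <= n.+1 * M)%N.
  elim: n => [|n IHn] x.
    rewrite mul0r => x0x g k Kk xE; rewrite mul1n; apply: (lf x0 g k) => //.
    by rewrite -xE; exact: le_lt_trans x0x e0.
  move=> x0x g k Kk xE.
  have [y [x0y yx]] : exists y, mdist x0 y <= n%:R * d /\ mdist y x <= d.
    have [le|lt] := leP (mdist x0 x) (n%:R * d).
      by exists x; rewrite mdistxx; split=> //; exact: ltW.
    have nd0 : 0 <= n%:R * d by rewrite mulr_ge0 // ltW.
    have [|y [x0y yx]] := @cat0_point_between x0 x (n%:R * d).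
      by rewrite nd0 ltW.
    exists y; rewrite x0y yx lexx; split=> //; rewrite lerBlDl.
    by move: x0x; rewrite -natr1 mulrDl mul1r.
  have [h [k' [Kk' yE]]] := KT y.
  have := IHn y x0y h k' Kk' yE => lenh.
  have : (len (h^-1 * g)%g <= M)%N.
    apply: (lf k' _ k) => //; rewrite (actM actP) metric_sym act_distV -xE -yE metric_sym.
    by apply: le_lt_trans yx _; rewrite /d; move: e0; lra.
  move=> lenhg; rewrite -[g](mulVKg h) mulSn addnC.
  by apply: leq_trans (lenM _ _) _; exact: leq_add.
have D0 : 0 <= D by apply: le_trans (KD x0 Kx0); exact: mdist_ge0.
(* A point at distance r takes at most r / d + 1 steps, and [chain] counts one more. *)
pose A := M%:R / d + 2 * M%:R.
have A0 : 0 <= A by rewrite addr_ge0 ?divr_ge0 ?mulr_ge0 // ltW.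
exists D, A; split=> //.
- move=> x; have [g [k [Kk ->]]] := KT x; exists g.
  by rewrite act_dist metric_sym; exact: KD.
- move=> g; set y := act g x0; pose n := (Num.truncn (mdist x0 y / d)).+1.
  have xn : mdist x0 y <= n%:R * d.
    by rewrite -ler_pdivrMr // ltW // truncnS_gt.
  have := chain n y xn g x0 Kx0 erefl; rewrite -(ler_nat R) => /le_trans; apply.
  have : (Num.truncn (mdist x0 y / d))%:R <= mdist x0 y / d.
    by rewrite truncn_le divr_ge0 ?mdist_ge0 // ltW.
  rewrite natrM -natr1 /n -natr1 => tn.
  have m0 : 0 <= mdist x0 y by exact: mdist_ge0.
  apply: (@le_trans _ _ ((mdist x0 y / d + 1 + 1) * M%:R)).
    by rewrite ler_wpM2r // !lerD.
  have h1 : 0 <= M%:R * mdist x0 y by rewrite mulr_ge0.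
  have h2 : 0 <= M%:R / d by rewrite divr_ge0 // ltW.
  by rewrite /A; lra.
move=> r; pose n := (Num.truncn (r / d)).+1.
pose U := \bigcup_(g in [set g | (len g <= n.+1 * M)%N]) (act g @` K).
have cU : compact U.
  have /finite_seqP[s sE] := finite_len_le e (n.+1 * M).
  rewrite /U sE bigcup_seq; apply: bigsetU_compact => g _.
  apply: continuous_compact => //; apply: continuous_subspaceT; exact: act_continuous.
apply: (subclosed_compact _ cU).
  move=> x clx; rewrite /= leNgt; apply/negP => rx.
  have rx0 : 0 < mdist x0 x - r by rewrite subr_gt0.
  have [y [/= x0y xy]] := clx _ (nbhs_mdist x rx0).
  have := metric_triangle x0 y x; rewrite (metric_sym y x); lra.
move=> x /= x0x; have [g [k [Kk xE]]] := KT x; exists g; last by exists k.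
apply: (chain n x _ g k Kk xE); apply: le_trans x0x _.
by rewrite -ler_pdivrMr // ltW // truncnS_gt.
Qed.

End Action.

(** * Geodesic rays and axes *)

Section Limits.
Local Open Scope ring_scope.
Variables (R : realType) (X : metricType R) (x0 : X).
Hypothesis proper : forall r : R, compact [set x : X | mdist x0 x <= r].

(** Tychonoff gives a cluster point rather than a convergent subsequence. This suffices, since a
    basic open set of the cone topology tests finitely many times only. *)
Lemma pointwise_cluster (f : nat -> R -> X) :
    (forall n s, mdist x0 (f n s) <= `|s|) ->
  exists F : R -> X, forall (T : seq R) (eps : R) N, 0 < eps ->
    exists2 n, (N <= n)%N & forall s, s \in T -> mdist (F s) (f n s) < eps.
Proof.
move=> fb; pose B (s : R) := [set x : X | mdist x0 x <= `|s|].
have cB : compact [set h : prod_topology (fun _ : R => X) | forall s, B s (h s)].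
  by apply: tychonoff => s; exact: proper.
pose G : set_system (prod_topology (fun _ : R => X)) := f @ \oo.
have [|F [_ clF]] := cB G _; first by apply: (@filterE _ \oo) => n s; exact: fb.
exists F => T eps N e0.
have nT : nbhs (F : prod_topology (fun _ : R => X))
    [set h | forall s, s \in T -> mdist (F s) (h s) < eps].
  have FF : Filter (nbhs (F : prod_topology (fun _ : R => X))) by exact: nbhs_filter.
  elim: T => [|t T IHT]; first by apply: filterE => h s; rewrite in_nil.
  have nt : nbhs (F : prod_topology (fun _ : R => X)) [set h | mdist (F t) (h t) < eps].
    exact: (@proj_continuous _ (fun _ : R => X) t F _ (nbhs_mdist (F t) e0)).
  apply: filterS (filterI nt IHT) => h [/= ht hT] s.
  by rewrite inE => /orP[/eqP->|/hT].
have [|h [[n Nn <-] hT]] := clF [set f n | n in [set n | (N <= n)%N]] _ _ nT.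
  by exists N => // n /= Nn; exists n.
by exists n.
Qed.

Lemma limit_ray (f : nat -> R -> X) :
    (forall n, f n 0 = x0) -> (forall n s, mdist x0 (f n s) <= `|s|) ->
    (forall s t, 0 <= s -> 0 <= t -> exists N, forall n, (N <= n)%N ->
      mdist (f n s) (f n t) = `|s - t|) ->
  exists F : geodesic_ray X, F 0 = x0 /\
    forall (T : seq R) (eps : R) N, 0 < eps ->
    exists2 n, (N <= n)%N & forall s, s \in T -> mdist (F s) (f n s) < eps.
Proof.
move=> f0 fb fi; have [F FP] := pointwise_cluster fb.
have Fi s t : 0 <= s -> 0 <= t -> mdist (F s) (F t) = `|s - t|.
  move=> s0 t0; have [N iN] := fi s t s0 t0.
  have close eps : 0 < eps ->
      `|s - t| <= mdist (F s) (F t) + eps /\ mdist (F s) (F t) <= `|s - t| + eps.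
    move=> e0; have e2 : 0 < eps / 2 by rewrite divr_gt0.
    have [n Nn nT] := FP [:: s; t] (eps / 2) N e2.
    have := nT s; have := nT t; rewrite !inE !eqxx orbT => /(_ isT) ht /(_ isT) hs.
    rewrite -(iN n Nn).
    have := metric_triangle (f n s) (F s) (f n t).
    have := metric_triangle (F s) (F t) (f n t).
    have := metric_triangle (F s) (f n s) (F t).
    have := metric_triangle (f n s) (f n t) (F t).
    rewrite (metric_sym (f n s) (F s)) (metric_sym (f n t) (F t)).
    by move: ht hs; lra.
  apply/eqP; rewrite eq_le; apply/andP; split; apply/ler_addgt0Pr => eps /close[] //.
exists (GeodesicRay Fi); split => //=.
apply: mdist_positivity; apply/eqP; rewrite eq_le mdist_ge0 andbT.
apply/ler_addgt0Pr => eps e0; have [n _] := FP [:: 0] eps 0%N e0.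
by move=> /(_ 0); rewrite inE eqxx f0 add0r => /(_ isT)/ltW.
Qed.

End Limits.

Section Rays.
Local Open Scope ring_scope.
Variables (R : realType) (X : metricType R).
Hypothesis X0 : CAT0 X.

Lemma ray_dist0 (c : geodesic_ray X) (s : R) : 0 <= s -> mdist (c 0) (c s) = s.
Proof. by move=> s0; rewrite ray_isometric // sub0r normrN ger0_norm. Qed.

Lemma ray_geodesic (c : geodesic_ray X) (r : R) : 0 <= r -> geodesic c (c 0) (c r).
Proof.
move=> r0; rewrite /geodesic ray_dist0 //; split=> // s t.
by rewrite !in_itv /= => /andP[s0 _] /andP[t0 _]; exact: ray_isometric.
Qed.

Lemma asymptotic_eq (c c' : geodesic_ray X) : c 0 = c' 0 -> asymptotic c c' ->
  forall s, 0 <= s -> c s = c' s.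
Proof.
move=> cc' [K cK] s s0; have [->//|sn0] := eqVneq s 0.
have sp : 0 < s by rewrite lt_neqAle eq_sym sn0.
have K0 : 0 <= K by apply: le_trans (cK 0 (lexx _)); exact: mdist_ge0.
apply: mdist_positivity; apply/eqP; rewrite eq_le mdist_ge0 andbT.
apply/ler_addgt0Pr => eps e0; rewrite add0r.
(* By convexity the distance at time s is at most s / t * K, and this t makes it at most eps. *)
pose t := s * (K / eps + 1).
have ke : 0 <= K / eps by rewrite divr_ge0 // ltW.
have tp : 0 < t by rewrite mulr_gt0 //; lra.
have st : s <= t by rewrite /t ler_peMr //; lra.
have t0 := ltW tp.
have lI : 0 <= s / t <= 1 by rewrite divr_ge0 //= ler_pdivrMr // mul1r.
have cG' : geodesic c' (c 0) (c' t) by rewrite cc'; exact: ray_geodesic.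
have := cat0_fan X0 (ray_geodesic c t0) cG' lI.
rewrite {2}cc' !ray_dist0 // divfK ?gt_eqF // => /le_trans; apply.
apply: (@le_trans _ _ (s / t * K)).
  by rewrite ler_wpM2l ?cK //; case/andP: lI.
rewrite mulrAC ler_pdivrMr // /t mulrCA ler_wpM2l // mulrDr mulr1.
by rewrite mulrC divfK ?gt_eqF // lerDl ltW.
Qed.

End Rays.

(** * Displacement functions, involutions and axes *)

Section Proper_Action.
Local Open Scope ring_scope.
Variables (R : realType) (V : finType) (e : rel V) (X : metricType R).
Local Notation W := (racg e).
Variable act : W -> X -> X.
Hypotheses (X0 : CAT0 X) (actP : geometric_action act).
Variables (x0 : X) (D A : R).
Hypotheses (cocompact : forall x, exists g, mdist x (act g x0) <= D)
  (len_le : forall g, (len g)%:R <= A * mdist x0 (act g x0) + A)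
  (proper : forall r : R, compact [set x : X | mdist x0 x <= r])
  (A0 : 0 <= A).
Implicit Types (x y z p q : X) (g h : W).

Lemma displacement_triangle g x y :
  mdist x (act g x) <= mdist y (act g y) + 2 * mdist x y.
Proof.
have := metric_triangle x y (act g x); have := metric_triangle y (act g y) (act g x).
rewrite (act_dist actP) (metric_sym y x); lra.
Qed.

Lemma finite_displacement_le r : finite_set [set g | mdist x0 (act g x0) <= r].
Proof.
apply: sub_finite_set (finite_len_le e (Num.truncn (A * r + A)).+1).
move=> g /= gr; rewrite -(ler_nat R); apply: le_trans (len_le g) _.
by apply: le_trans (ltW (truncnS_gt _)); rewrite lerD2r ler_wpM2l.
Qed.

(** An involution reverses the geodesic from x0 to its image, hence fixes the midpoint. *)
Lemma involution_fixpoint g : (g * g = 1)%g -> exists x, act g x = x.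
Proof.
move=> g2; have [c cG] := cat0_geodesic X0 x0 (act g x0).
exists (c (2^-1 * mdist x0 (act g x0))).
have := act_geodesic actP g cG; rewrite -(actM actP) g2 (act1 actP) => cG'.
have := geodesic_rev cG'; rewrite (metric_sym (act g x0) x0) => cG''.
have l01 : 0 <= (2^-1 : R) <= 1 by lra.
have := cat0_geodesic_uniq X0 cG cG'' (scale_itv l01 (mdist_ge0 _ _)).
set d := mdist x0 (act g x0); have -> : d - 2^-1 * d = 2^-1 * d by lra.
by move=> <-.
Qed.

Lemma finitely_many_involutions : exists2 Fin : set W, finite_set Fin &
  forall g, (g * g = 1)%g -> exists h, Fin (g ^ h)%g.
Proof.
exists [set g | mdist x0 (act g x0) <= 2 * D]; first exact: finite_displacement_le.
move=> g /involution_fixpoint[x gx]; have [h xh] := cocompact x; exists h => /=.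
have h'x : mdist x0 (act h^-1%g x) <= D by rewrite metric_sym (act_distV actP).
apply: le_trans (displacement_triangle _ _ (act h^-1%g x)) _.
rewrite conjgE !(actM actP) (actKV actP) gx mdistxx add0r.
by rewrite ler_pM2l.
Qed.

(** Cocompactness moves a minimum search over X into the ball of radius D, at the price of replacing
    g by conjugates. Those that matter move x0 by at most r, so they are finitely many. *)
Lemma min_displacement g : exists q, forall x, mdist q (act g q) <= mdist x (act g x).
Proof.
pose r := 2 * D + mdist x0 (act g x0).
have /finite_seqP[s sE] := finite_displacement_le r.
pose ball0 := [set x : X | mdist x0 x <= D].
have ball0_ne : ball0 !=set0.
  have [h xh] := cocompact x0; exists x0; rewrite /ball0 /= mdistxx.
  by apply: le_trans xh; exact: mdist_ge0.
have /choice[m mP] : forall h, exists m, ball0 m /\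
    forall x, ball0 x -> mdist m (act h m) <= mdist x (act h x).
  move=> h; have [|||m mB mmin] := @compact_EVT_min X R (fun x => mdist x (act h x)) ball0.
  - exact: ball0_ne.
  - exact: proper.
  - apply: continuous_subspaceT => x B /nbhs_ballP[eps /= e0 xB].
    have e2 : 0 < eps / 2 by rewrite divr_gt0.
    apply/nbhs_ballP; exists (eps / 2) => //= y; rewrite ballEmdist /= => xy.
    apply: xB; rewrite /ball /= ltr_norml.
    have := displacement_triangle h x y; have := displacement_triangle h y x.
    rewrite (metric_sym y x); move: xy; lra.
  by exists m; split; [rewrite -inE|move=> x xB; apply: mmin; rewrite inE].
pose s' := [seq h <- s | `[< exists a, h = (g ^ a)%g >]].
have min_s (t : seq W) : t != [::] -> exists2 h, h \in t &
    forall h', h' \in t -> mdist (m h) (act h (m h)) <= mdist (m h') (act h' (m h')).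
  elim: t => [//|h t IHt] _; have [->|t0] := eqVneq t [::].
    by exists h; rewrite ?mem_head // => h'; rewrite inE => /eqP ->.
  have [h1 h1t h1min] := IHt t0.
  have [le|/ltW le] := leP (mdist (m h) (act h (m h))) (mdist (m h1) (act h1 (m h1))).
    exists h; first exact: mem_head.
    by move=> h'; rewrite inE => /orP[/eqP->//|/h1min]; exact: le_trans.
  exists h1; first by rewrite inE h1t orbT.
  by move=> h'; rewrite inE => /orP[/eqP->//|/h1min].
have gs' : g \in s'.
  rewrite mem_filter; apply/andP; split.
    by apply/asboolP; exists 1%g; rewrite conjg1.
  have : [set` s] g; last by [].
  rewrite -sE /= /r; have [y yB] := ball0_ne.
  have : 0 <= D by apply: le_trans yB; exact: mdist_ge0.
  lra.
have [|h hs' hmin] := min_s s'; first by apply: contraTneq gs' => ->.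
have conjE a x : mdist x (act (g ^ a)%g x) = mdist (act a x) (act g (act a x)).
  by rewrite conjgE !(actM actP) metric_sym (act_distV actP) metric_sym.
move: (hs'); rewrite mem_filter => /andP[/asboolP[a hE] _].
exists (act a (m h)) => x; rewrite -conjE -hE.
have [le|/ltW ge] := leP (mdist x0 (act g x0)) (mdist x (act g x)).
  apply: le_trans (hmin g gs') _; apply: le_trans ((mP g).2 x0 _) le.
  rewrite /ball0 /= mdistxx; have [y yB] := ball0_ne.
  by apply: le_trans yB; exact: mdist_ge0.
have [b xb] := cocompact x.
have b'x : mdist x0 (act b^-1%g x) <= D by rewrite metric_sym (act_distV actP).
have gb : mdist (act b^-1%g x) (act (g ^ b)%g (act b^-1%g x)) = mdist x (act g x).
  by rewrite conjE (actKV actP).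
rewrite -gb; apply: le_trans ((mP (g ^ b)%g).2 _ b'x); apply: hmin.
rewrite mem_filter; apply/andP; split; first by apply/asboolP; exists b.
have : [set` s] (g ^ b)%g; last by [].
rewrite -sE /=; apply: le_trans (displacement_triangle _ _ (act b^-1%g x)) _.
by rewrite gb /r addrC lerD // ler_pM2l.
Qed.

(** The midpoint of x and g x is moved by g to that of g x and g^2 x, so its displacement is at most
    half the distance from x to g^2 x. *)
Lemma displacement_double g (t : R) : (forall x, t <= mdist x (act g x)) ->
  forall x, 2 * t <= mdist x (act (g * g)%g x).
Proof.
move=> gt x; have [c cG] := cat0_geodesic X0 x (act g x).
have l01 : 0 <= (2^-1 : R) <= 1 by lra.
have := cat0_fan X0 (geodesic_rev cG) (act_geodesic actP g cG) l01.
rewrite (act_dist actP) (metric_sym (act g x) x).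
set d := mdist x (act g x).
have -> : d - 2^-1 * d = 2^-1 * d by lra.
move=> /(le_trans (gt _)); rewrite (actM actP); lra.
Qed.

(** Doubling bounds displacements below at powers of 2 only. At q the other exponents follow by
    splitting 2 ^ n as n + (2 ^ n - n) and using the upper bounds. *)
Lemma axis g : exists q (t : R), [/\ 0 <= t,
  forall n, mdist q (act (g ^+ n)%g q) = n%:R * t &
  forall x k, (2 ^ k)%:R * t <= mdist x (act (g ^+ (2 ^ k))%g x)].
Proof.
have [q qmin] := min_displacement g; set t := mdist q (act g q) in qmin.
have t0 : 0 <= t by exact: mdist_ge0.
have lower k : forall x, (2 ^ k)%:R * t <= mdist x (act (g ^+ (2 ^ k))%g x).
  elim: k => [|k IHk] x; first by rewrite expn0 mul1r expg1.
  rewrite expnS natrM -mulrA mul2n -addnn expgnDr; exact: displacement_double.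
have upper n : mdist q (act (g ^+ n)%g q) <= n%:R * t.
  elim: n => [|n IHn]; first by rewrite expg0 (act1 actP) mdistxx mul0r.
  rewrite expgSr (actM actP) -natr1 mulrDl mul1r.
  apply: le_trans (metric_triangle _ (act (g ^+ n)%g q) _) _.
  by rewrite (act_dist actP) lerD.
exists q, t; split=> // n; apply/eqP; rewrite eq_le upper /=.
have n2 : (n <= 2 ^ n)%N by rewrite ltnW // ltn_expl.
have := lower n q; have := upper (2 ^ n - n)%N.
have := metric_triangle q (act (g ^+ n)%g q) (act (g ^+ (2 ^ n))%g q).
rewrite -{2}(subnKC n2) expgnDr (actM actP) (act_dist actP) natrB //.
lra.
Qed.

Lemma axis_translation_gt0 g q (t : R) : injective (fun n => g ^+ n)%g -> 0 <= t ->
  (forall n, mdist q (act (g ^+ n)%g q) = n%:R * t) -> 0 < t.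
Proof.
move=> ginj t0 gq; rewrite lt_neqAle t0 andbT; apply/eqP => tE.
apply: infinite_nat; have -> : [set: nat] =
    (fun n => g ^+ n)%g @^-1` [set h | mdist x0 (act h x0) <= 2 * mdist x0 q].
  apply/esym/seteqP; split=> // n _ /=; apply: le_trans (displacement_triangle _ _ q) _.
  by rewrite gq -tE mulr0 add0r.
by apply: finite_preimage (finite_displacement_le _) => m n _ _; exact: ginj.
Qed.

End Proper_Action.

(** * The boundary is not locally connected *)

Section Boundary_Topology.
Local Open Scope ring_scope.
Variables (R : realType) (X : metricType R) (x0 : X).
Hypothesis X0 : CAT0 X.
Implicit Types (c : geodesic_ray X) (P : geodesic_ray X -> Prop).
Local Notation bpoint c := (\pi_(boundary X)%qT c : visual_boundary x0).

Lemma boundary_eq c c' : c 0 = x0 -> c' 0 = x0 -> bpoint c = bpoint c' ->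
  forall s, 0 <= s -> c s = c' s.
Proof.
move=> c0 c'0 /eqmodP/asboolP; apply: asymptotic_eq => //.
by rewrite c0.
Qed.

Lemma open_rays P : (forall c, P c -> c 0 = x0) ->
    (forall c, P c -> exists r eps : R, [/\ 0 < r, 0 < eps &
      forall c', c' 0 = x0 -> mdist (c r) (c' r) < eps -> P c']) ->
  open [set bpoint c | c in P].
Proof.
move=> P0 Popen; rewrite openE => _ [c Pc <-]; have [r [eps [r0 e0 near_c]]] := Popen c Pc.
have := cone_nbhd_open (P0 c Pc) r0 e0; rewrite openE => op.
rewrite /interior; apply: filterS (op (bpoint c) _).
  by move=> _ [c' [c'0 cc'] <-]; exists c' => //; exact: near_c.
by exists c => //; split; [exact: P0|rewrite mdistxx].
Qed.

(** Each subbasic set around another ray is shrunk to one centred at c, by the triangle inequality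
    at its time. *)
Lemma cone_base c (U : set (visual_boundary x0)) : c 0 = x0 -> open U -> U (bpoint c) ->
  exists (T : seq R) (eps : R), [/\ 0 < eps, all (>= 0) T & forall c', c' 0 = x0 ->
    (forall s, s \in T -> mdist (c s) (c' s) < eps) -> U (bpoint c')].
Proof.
move=> c0 [B subB <-] [A BA Ac].
have [F Fsub FA] := subB A BA.
have [s [sZ sA]] : exists s : seq (set (boundary X)),
    (forall Z, Z \in s -> cone_subbase x0 Z /\ Z (bpoint c)) /\
    (forall y, (forall Z, Z \in s -> Z y) -> A y).
  exists (finmap.enum_fset F); split=> [Z ZF|y yF]; last by rewrite -FA => Z /yF.
  split; first by have := Fsub Z ZF; rewrite inE.
  by move: Ac; rewrite -FA; apply.
suff [T [eps [e0 T0 TF]]] : exists (T : seq R) (eps : R), [/\ 0 < eps, all (>= 0) T &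
    forall c', c' 0 = x0 -> (forall s, s \in T -> mdist (c s) (c' s) < eps) ->
    forall Z, Z \in s -> Z (bpoint c')].
  exists T, eps; split=> // c' c'0 cc'; exists A => //; apply: sA => Z.
  exact: TF.
elim: s sZ {sA} => [|Z s IHs] Zc; first by exists [::], 1.
have [|T [eps [e0 T0 TF]]] := IHs; first by move=> Y Ys; apply: Zc; rewrite inE Ys orbT.
have [[a [r [d [a0 r0 d0 ZE]]]]] := Zc Z (mem_head _ _).
rewrite ZE => -[b [b0 ab] bc].
have br : b r = c r by apply: boundary_eq => //; exact: ltW.
rewrite br in ab.
exists (r :: T), (Num.min eps (d - mdist (a r) (c r))); split.
- by rewrite lt_min e0 subr_gt0.
- by rewrite /= ltW.
move=> c' c'0 cc' Y; rewrite inE => /orP[/eqP->|].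
  exists c' => //; split=> //.
  have := cc' r (mem_head _ _); rewrite lt_min => /andP[_ h].
  by have := metric_triangle (a r) (c r) (c' r); lra.
apply: TF => // s' s'T.
by have := cc' s'; rewrite inE s'T orbT lt_min => /(_ isT) /andP[].
Qed.

End Boundary_Topology.

(** * Rays crossing the translates of C *)

Section SIL_NLC.
Local Open Scope ring_scope.
Variables (R : realType) (V : finType) (e : rel V) (X : metricType R).
Hypotheses (e_sym : symmetric e) (e_irr : irreflexive e).
Local Notation W := (racg e).
Local Notation gen := (racg_gen e).
Variables (v w u : V) (K : {set V}).
Hypotheses (vwK : SIL e v w K) (uK : u \in K).
Variable act : W -> X -> X.
Hypotheses (X0 : CAT0 X) (actP : geometric_action act).
Variables (x0 : X) (D A : R).
Hypotheses (D0 : 0 <= D) (A0 : 0 <= A)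
  (cocompact : forall x, exists g, mdist x (act g x0) <= D)
  (len_le : forall g, (len g)%:R <= A * mdist x0 (act g x0) + A)
  (proper : forall r : R, compact [set x : X | mdist x0 x <= r]).
Implicit Types (x y : X) (g h : W) (m n k : nat).

Local Notation t := (trans e v w).
Local Notation s := (transverse e v u).
Local Notation C := (@special V e (links e v w)).
Local Notation side := (@side V e v w K).
Local Notation near x g := (mdist x (act g x0) <= D).

Lemma word_metric_le : exists2 L : R, 0 <= L &
  forall g, mdist x0 (act g x0) <= L * (len g)%:R.
Proof.
pose L := \sum_(a : V) mdist x0 (act (gen a) x0).
have L0 : 0 <= L by apply: sumr_ge0 => a _; exact: mdist_ge0.
exists L => // g; have [z <- <-] := len_min_word g.
elim: z => [|a z IHz]; first by rewrite word_nil (act1 actP) mdistxx mulr0.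
rewrite word_cons (actM actP) /= -natr1 mulrDr mulr1 addrC.
apply: le_trans (metric_triangle _ (act (gen a) x0) _) _.
rewrite (act_dist actP) lerD // /L (bigD1 a) //= lerDl.
by apply: sumr_ge0 => b _; exact: mdist_ge0.
Qed.

Lemma near_len x y g h (r : R) : near x g -> near y h -> mdist x y <= r ->
  (len (g^-1 * h)%g)%:R <= A * (r + 2 * D) + A.
Proof.
move=> xg yh xy; apply: le_trans (len_le _) _; rewrite lerD2r ler_wpM2l //.
rewrite (actM actP) metric_sym (act_distV actP) metric_sym.
have := metric_triangle (act g x0) x (act h x0); have := metric_triangle x y (act h x0).
rewrite (metric_sym (act g x0) x); lra.
Qed.

Lemma side_crossing (L : R) : 0 <= L ->
    (forall g, mdist x0 (act g x0) <= L * (len g)%:R) ->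
  forall x y g h m (r : R), near x g -> near y h -> mdist x y <= r ->
    ~ side (t ^- m * g)%g -> side (t ^- m * h)%g ->
  exists2 c, C c & mdist y (act (t ^+ m * c)%g x0) <= D + L * (A * (r + 2 * D) + A).
Proof.
move=> L0 HL x y g h m r xg yh xy ng sh.
have [c Cc] := side_cross e_sym vwK ng sh.
have -> : ((t ^- m * h)^-1 * c = h^-1 * (t ^+ m * c))%g by rewrite invgM invgK mulgA.
have -> : ((t ^- m * g)^-1 * (t ^- m * h) = g^-1 * h)%g.
  by rewrite invgM invgK -mulgA mulVKg.
move=> le_len; exists c => //.
apply: le_trans (metric_triangle _ (act h x0) _) _; rewrite lerD //.
have -> : mdist (act h x0) (act (t ^+ m * c)%g x0) =
    mdist x0 (act (h^-1 * (t ^+ m * c))%g x0).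
  by rewrite (actM actP h^-1%g) [RHS]metric_sym (act_distV actP) metric_sym.
apply: le_trans (HL _) _; rewrite ler_wpM2l //.
by apply: le_trans (near_len xg yh xy); rewrite ler_nat.
Qed.

Section Translation_Axis.
Variables (qt qs : X) (tau sigma : R).
Hypotheses (tau0 : 0 < tau) (sigma0 : 0 < sigma)
  (qtP : forall n, mdist qt (act (t ^+ n)%g qt) = n%:R * tau)
  (tau_le : forall x k, (2 ^ k)%:R * tau <= mdist x (act (t ^+ (2 ^ k))%g x))
  (qsP : forall n, mdist qs (act (s ^+ n)%g qs) = n%:R * sigma).

Let A1 := 2 * mdist x0 qt + mdist x0 (act (gen v) x0).

Lemma trans_dist_le n : mdist x0 (act (t ^+ n)%g x0) <= n%:R * tau + 2 * mdist x0 qt.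
Proof. by have := displacement_triangle actP (t ^+ n)%g x0 qt; rewrite qtP. Qed.

Lemma conj_trans n : (gen v * t ^+ n = t ^- n * gen v)%g.
Proof. by rewrite -(transJ e v w) -mulgA racg_gen_square mulg1. Qed.

Lemma reflect_dist_le n : mdist x0 (act (t ^+ n * gen v)%g x0) <= n%:R * tau + A1.
Proof.
rewrite (actM actP); apply: le_trans (metric_triangle _ (act (t ^+ n)%g x0) _) _.
by rewrite (act_dist actP) /A1 addrA lerD2r trans_dist_le.
Qed.

(** Both isometries are conjugates of v or w. As n grows, their fixed sets move to the attracting
    end of t for [dplus] and to the repelling end for [dminus]. *)
Definition dplus n x := mdist x (act (t ^+ n * gen v)%g x).
Definition dminus n x := mdist x (act (gen v * t ^+ n)%g x).

Lemma dplus_dminus k x :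
  2 * ((2 ^ k)%:R * tau) <= dplus (2 ^ k) x + dminus (2 ^ k) x.
Proof.
have := tau_le (act (gen v) x) k.+1; rewrite expnS natrM -mulrA => /le_trans; apply.
set n := (2 ^ k)%N; rewrite mul2n -addnn.
have := metric_triangle (act (t ^+ n * gen v)%g x) x (act (gen v * t ^+ n)%g x).
rewrite -/(dminus n x) (metric_sym _ x) -/(dplus n x) conj_trans; apply: le_trans.
by rewrite expgnDr !(actM actP) [leRHS]metric_sym (act_distV actP).
Qed.

(** Conjugation by t ^ m c turns t ^ n v into t ^ (n - 2 m) v, because c commutes with v and t while
    v inverts t. *)
Lemma dplus_trans m n c : C c -> (2 * m <= n)%N ->
  dplus n (act (t ^+ m * c)%g x0) <= (n%:R - 2 * m%:R) * tau + A1.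
Proof.
move=> Cc mn; have [vc _] := links_commute Cc; have ct := trans_commute m Cc.
have E : (t ^+ n * gen v * (t ^+ m * c) = t ^+ m * c * (t ^+ (n - 2 * m) * gen v))%g.
  have -> : (n = m + m + (n - 2 * m))%N by lia.
  set l := (n - 2 * m)%N.
  rewrite (_ : (m + m + l - 2 * m)%N = l); last by rewrite /l; lia.
  have ctl := trans_commute l Cc; have ctm := trans_commute m Cc.
  rewrite -!mulgA [(gen v * _)%g]mulgA conj_trans -!mulgA vc.
  have E1 : (t ^+ (m + m + l) * t ^- m = t ^+ m * t ^+ l)%g.
    by rewrite -addnA [(m + (m + l))%N]addnC expgnDr mulgK expgnDr.
  by rewrite (mulgA _ (t ^- m)%g) E1 -!mulgA (mulgA _ c) -ctl -!mulgA.
rewrite /dplus -(actM actP) E (actM actP (t ^+ m * c)%g) (act_dist actP).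
by have := reflect_dist_le (n - 2 * m); rewrite natrB // natrM.
Qed.

Lemma dminus_trans m n c : C c ->
  dminus n (act (t ^+ m * c)%g x0) <= (n%:R + 2 * m%:R) * tau + A1.
Proof.
move=> Cc; have [vc _] := links_commute Cc; have ctm := trans_commute m Cc.
have E : (gen v * t ^+ n * (t ^+ m * c) = t ^+ m * c * (gen v * t ^+ (n + 2 * m)))%g.
  have tv : (t ^+ m * gen v = gen v * t ^- m)%g.
    by apply: (mulgI (t ^- m)%g); rewrite mulKg mulgA -conj_trans mulgK.
  have E1 : (t ^- m * t ^+ (n + 2 * m) = t ^+ n * t ^+ m)%g.
    rewrite (_ : (n + 2 * m)%N = (m + (n + m))%N); last by lia.
    by rewrite expgnDr mulKg expgnDr.
  rewrite -ctm -!mulgA (mulgA (t ^+ m)%g (gen v)) tv -!mulgA E1.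
  by rewrite (mulgA c) -vc -mulgA (mulgA c) (trans_commute n Cc) -mulgA.
rewrite /dminus -(actM actP) E (actM actP (t ^+ m * c)%g) (act_dist actP).
rewrite (actM actP) metric_sym -(act_dist actP (gen v)) -(actM actP) racg_gen_square.
rewrite (act1 actP); apply: le_trans (metric_triangle _ x0 _) _.
rewrite metric_sym /A1 addrA lerD //.
by have := trans_dist_le (n + 2 * m); rewrite natrD natrM.
Qed.

Lemma displacement_ray g (c : geodesic_ray X) (r l : R) : 0 <= r <= l -> 0 < l ->
  mdist (c r) (act g (c r)) <=
  (1 - r / l) * mdist (c 0) (act g (c 0)) + r / l * mdist (c l) (act g (c l)).
Proof.
move=> /andP[r0 rl] l0; have cG := ray_geodesic c (ltW l0).
have lI : 0 <= r / l <= 1 by rewrite divr_ge0 ?(ltW l0) //= ler_pdivrMr // mul1r.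
have := cat0_convex X0 cG (act_geodesic actP g cG) lI.
by rewrite (act_dist actP) (ray_dist0 c (ltW l0)) divfK // gt_eqF.
Qed.

Lemma transverse_ray m : exists rho : geodesic_ray X, rho 0 = x0 /\
  forall i : nat, mdist (rho (i%:R * sigma)) (act (t ^+ m * s ^+ i)%g x0) <=
    2 * mdist x0 (act (t ^+ m)%g qs) + 1 + mdist x0 qs.
Proof.
set d := mdist x0 _; pose y n := act (t ^+ m * s ^+ n)%g qs.
have d0 : 0 <= d by exact: mdist_ge0.
have dy i n : mdist (y i) (y (i + n)%N) = n%:R * sigma.
  by rewrite /y !(actM actP) expgnDr (actM actP) !(act_dist actP) qsP.
have dy0 n : mdist (y 0%N) (y n) = n%:R * sigma by exact: dy 0%N n.
have y0 : mdist x0 (y 0%N) = d by rewrite /y expg0 mulg1.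
have /choice[c cG] : forall n, exists c : R -> X, geodesic c x0 (y n).
  by move=> n; exact: cat0_geodesic.
pose l n := mdist x0 (y n); have l0 n : 0 <= l n by exact: mdist_ge0.
have ly n : `|l n - n%:R * sigma| <= d.
  have := metric_triangle x0 (y 0%N) (y n); have := metric_triangle (y 0%N) x0 (y n).
  rewrite dy0 (metric_sym (y 0%N) x0) y0 -/(l n) ler_norml; lra.
(* The n-th geodesic lives on [0, l n]; clamping extends it to all times within the bound that
   [limit_ray] requires. *)
pose clamp n (r : R) := Num.min (Num.max 0 r) (l n).
have clampI n r : clamp n r \in `[0, l n].
  by rewrite in_itv /= le_min l0 le_max lexx /= ge_min lexx orbT.
have clampE n (r : R) : 0 <= r -> r <= l n -> clamp n r = r.
  by move=> r0 rl; rewrite /clamp max_r // min_l.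
pose f n (r : R) := c n (clamp n r).
have large (r : R) : exists N, forall n, (N <= n)%N -> r <= l n.
  exists (Num.truncn ((r + d) / sigma)).+1 => n Nn.
  have : (r + d) / sigma <= n%:R.
    by apply: le_trans (ltW (truncnS_gt _)) _; rewrite ler_nat.
  rewrite ler_pdivrMr // => h; have := ly n; rewrite ler_norml; lra.
have [|||rho [rho0 rhoP]] := @limit_ray R X x0 proper f.
- move=> n; have [c0 _ _] := cG n; rewrite /f clampE //.
- move=> n r; rewrite /f (geodesic_dist0 (cG n)) // /clamp ge_min ge_max normr_ge0.
  by rewrite ler_norm.
- move=> r r' r0 r'0; have [N NP] := large (Num.max r r'); exists N => n /NP.
  rewrite ge_max => /andP[rl r'l]; have [_ _ ci] := cG n.
  by rewrite /f ci // !clampE.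
exists rho; split=> // i.
have [N NP] := large (i%:R * sigma).
have [n Nn nP] := rhoP [:: i%:R * sigma] 1 (maxn N i.+1) ltr01.
have {nP} := nP _ (mem_head _ _).
move: Nn; rewrite geq_max => /andP[/NP il ni].
have i0 : 0 <= i%:R * sigma by rewrite mulr_ge0 // ltW.
have n0 : 0 < n%:R :> R by rewrite ltr0n; exact: leq_ltn_trans ni.
rewrite /f clampE // => rc.
(* This segment follows the translated axis and shares its endpoint with [c n]: by convexity they
   stay within d, and the different speeds cost at most another d. *)
have [g gG] := cat0_geodesic X0 (y 0%N) (y n).
have gi : g (i%:R * sigma) = y i.
  have := cat0_between X0 gG (p := y i).
  rewrite dy0; apply; rewrite dy0 -(subnKC (ltnW ni)) dy.
  by rewrite natrD mulrDl.
have lI : 0 <= (i%:R / n%:R : R) <= 1.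
  by rewrite divr_ge0 //= ler_pdivrMr // mul1r ler_nat ltnW.
have := cat0_convex X0 (cG n) gG lI; rewrite -/(l n).
rewrite dy0 mulrA divfK ?gt_eqF // gi mdistxx mulr0 addr0 y0 => cy.
have [_ _ ci] := cG n.
have cc : mdist (c n (i%:R * sigma)) (c n (i%:R / n%:R * l n)) <= d.
  rewrite ci ?in_itv /= ?i0 ?il //; last first.
    by case/andP: lI => h1 h2; rewrite mulr_ge0 //= ler_piMl.
  have -> : i%:R * sigma - i%:R / n%:R * l n = i%:R / n%:R * (n%:R * sigma - l n).
    by rewrite mulrBr mulrA divfK ?gt_eqF.
  case/andP: lI => h1 h2; rewrite normrM (ger0_norm h1) distrC.
  by apply: le_trans (ly n); rewrite ler_piMl.
have yx : mdist (y i) (act (t ^+ m * s ^+ i)%g x0) = mdist x0 qs.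
  by rewrite /y (act_dist actP) metric_sym.
have := metric_triangle (rho (i%:R * sigma)) (y i) (act (t ^+ m * s ^+ i)%g x0).
have := metric_triangle (rho (i%:R * sigma)) (c n (i%:R * sigma)) (y i).
have := metric_triangle (c n (i%:R * sigma)) (c n (i%:R / n%:R * l n)) (y i).
have : (1 - i%:R / n%:R) * d <= d.
  by case/andP: lI => h1 h2; rewrite ler_piMl // gerBl.
rewrite yx; lra.
Qed.

(** The ray stays within a distance linear in m of the points t ^ m s ^ i x0, while t ^ m s ^ i is
    at word distance at least i from t ^ m C. *)
Lemma transverse_ray_side : exists a b : R, [/\ 0 <= a, 0 <= b & forall m,
  exists rho : geodesic_ray X, rho 0 = x0 /\ forall (i : nat) g,
    a * m%:R + b < i%:R -> near (rho (i%:R * sigma)) g -> side (t ^- m * g)%g].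
Proof.
have tau0' := ltW tau0.
pose E := 2 * (2 * mdist x0 qt + mdist x0 qs) + 1 + mdist x0 qs + D.
have E0 : 0 <= E.
  by rewrite /E; have := mdist_ge0 x0 qt; have := mdist_ge0 x0 qs; move: D0; lra.
exists (A * (2 * tau)), (A * E + A); split.
- by rewrite !mulr_ge0.
- by rewrite addr_ge0 // mulr_ge0.
move=> m; have [rho [rho0 rhoP]] := transverse_ray m; exists rho; split=> // i g lti rg.
have i_gt0 : (0 < i)%N.
  rewrite -(ltr_nat R); apply: le_lt_trans lti.
  by rewrite !addr_ge0 // !mulr_ge0.
apply: contrapT => ng.
have sh : side (t ^- m * (t ^+ m * s ^+ i))%g.
  by rewrite mulKg -(prednK i_gt0); exact: (transverse_side e_sym e_irr vwK uK).
have [c Cc le_c] := side_cross e_sym vwK ng sh.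
have := leq_trans (transverse_len e_sym e_irr vwK uK i Cc); move: le_c.
rewrite mulKg => /[swap] /[apply].
rewrite invgM invgK -mulgA -(ler_nat R) leNgt => /negP; apply.
apply: le_lt_trans lti; apply: le_trans (len_le _) _.
rewrite addrA lerD2r -mulrA -mulrDr ler_wpM2l //.
have -> : mdist x0 (act (g^-1 * (t ^+ m * s ^+ i))%g x0) =
    mdist (act g x0) (act (t ^+ m * s ^+ i)%g x0).
  by rewrite (actM actP) metric_sym (act_distV actP) metric_sym.
have := rhoP i; set y := act _ x0 => ry.
have := metric_triangle (act g x0) (rho (i%:R * sigma)) y.
rewrite (metric_sym (act g x0) (rho _)).
have := metric_triangle x0 (act (t ^+ m)%g x0) (act (t ^+ m)%g qs).
rewrite (act_dist actP); have := trans_dist_le m.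
move: ry rg; rewrite /E; lra.
Qed.

Lemma ray_crossing (L a b : R) m (rho : geodesic_ray X) :
    0 <= L -> (forall g, mdist x0 (act g x0) <= L * (len g)%:R) ->
    0 <= a -> 0 <= b -> rho 0 = x0 ->
    (forall (i : nat) g, a * m%:R + b < i%:R -> near (rho (i%:R * sigma)) g ->
      side (t ^- m * g)%g) ->
  exists T c, [/\ 0 <= T <= sigma * (a * m%:R + b + 1), C c &
    mdist (rho T) (act (t ^+ m * c)%g x0) <= D + L * (A * (sigma + 2 * D) + A)].
Proof.
move=> L0 HL a0 b0 rho0 rhoS.
have /choice[g gP] : forall i : nat, exists g, near (rho (i%:R * sigma)) g.
  by move=> i; exact: cocompact.
(* Choosing 1 at time 0 makes the ray start outside the translated side. *)
pose g' i := if i is 0 then 1%g else g i.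
have g'P i : near (rho (i%:R * sigma)) (g' i).
  by case: i => [|i] //; rewrite mul0r rho0 (act1 actP) mdistxx.
pose i0 := (Num.truncn (a * m%:R + b)).+1.
have abi0 : a * m%:R + b < i0%:R by exact: truncnS_gt.
have exi : exists i, `[< side (t ^- m * g' i)%g >].
  by exists i0; apply/asboolP; exact: rhoS (g'P i0).
case: (ex_minnP exi) => j /asboolP sj j_min.
have ji0 : (j <= i0)%N by apply: j_min; apply/asboolP; exact: rhoS (g'P i0).
case: j sj j_min ji0 => [|j] sj j_min ji0.
  case: (@side_notin _ e v w K (t ^- m * g' 0%N)%g) => //.
  by rewrite mulg1; apply: specialV; exact: (trans_special vwK).
have nsj : ~ side (t ^- m * g' j)%g.
  by move=> sj'; have := j_min j; rewrite ltnn => /(_ (asboolT sj')).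
have sig := ltW sigma0.
have dj : mdist (rho (j%:R * sigma)) (rho (j.+1%:R * sigma)) <= sigma.
  rewrite ray_isometric ?mulr_ge0 // -mulrBl -natr1 opprD addrA subrr add0r.
  by rewrite mulN1r normrN ger0_norm.
have [c Cc rc] := side_crossing L0 HL (g'P j) (g'P j.+1) dj nsj sj.
exists (j.+1%:R * sigma), c; split=> //.
rewrite mulr_ge0 //= mulrC ler_wpM2l //.
apply: le_trans (_ : i0%:R <= _); first by rewrite ler_nat.
rewrite /i0 -natr1 lerD2r truncn_le.
by rewrite addr_ge0 // mulr_ge0.
Qed.

(* As k grows dminus (2 ^ k) x - 2 ^ k * tau approximates a Busemann function
   of the repelling end of the axis of t; escapes x th says that it exceeds
   th. Unlike a Busemann function it is visibly invariant under C. *)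
Definition escapes x (th : R) :=
  exists k, th + (2 ^ k)%:R * tau < dminus (2 ^ k) x.

Lemma escapes_near x y (th d : R) : escapes x th -> mdist x y <= d ->
  escapes y (th - 2 * d).
Proof.
move=> [k xk] xy; exists k;
have := displacement_triangle actP (gen v * t ^+ (2 ^ k))%g x y.
move: xk; rewrite /dminus; lra.
Qed.

Lemma escapes_trans m c (th : R) : C c -> escapes (act (t ^+ m * c)%g x0) th ->
  th < 2 * m%:R * tau + A1.
Proof. by move=> Cc [k]; have := dminus_trans m (2 ^ k) Cc; lra. Qed.

Lemma dminus_base n : dminus n x0 <= n%:R * tau + A1.
Proof.
have := dminus_trans 0 n (special1 e _); rewrite mulg1 expg0 (act1 actP).
by rewrite mulr0 addr0.
Qed.

Lemma dplus_base n : dplus n x0 <= n%:R * tau + A1.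
Proof. exact: reflect_dist_le. Qed.

(** A displacement is convex along the ray and at most 2 ^ k * tau + A1 at time 0; once above the
    line of slope kappa from that value, it stays above. *)
Lemma escapes_ray (c : geodesic_ray X) (kappa r l : R) : c 0 = x0 -> 0 < r -> r <= l ->
  escapes (c r) (A1 + kappa * r) -> escapes (c l) (A1 + kappa * l).
Proof.
move=> c0 r0 rl [k ck]; exists k; have l0 := lt_le_trans r0 rl.
have rI : 0 <= r <= l by rewrite ltW.
have := displacement_ray (gen v * t ^+ (2 ^ k))%g c rI l0.
rewrite -/(dminus _ (c r)) -/(dminus _ (c l)) c0 -/(dminus _ x0).
have := dminus_base (2 ^ k); set n := (2 ^ k)%:R * tau in ck *.
have q0 : 0 < r / l by rewrite divr_gt0.
have q1 : r / l <= 1 by rewrite ler_pdivrMr // mul1r.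
have rE : r = r / l * l by rewrite divfK // gt_eqF.
move=> h1 h2; rewrite -(ltr_pM2l q0).
have h3 : (1 - r / l) * dminus (2 ^ k) x0 <= (1 - r / l) * (n + A1).
  by rewrite ler_wpM2l // subr_ge0.
have h4 : A1 + kappa * (r / l * l) + n <
    (1 - r / l) * (n + A1) + r / l * dminus (2 ^ k) (c l).
  by rewrite -rE; lra.
move: h4; set q := r / l; lra.
Qed.

Lemma escaping_rays : exists a b kappa r : R, exists m0 : nat,
  [/\ 0 < kappa, 0 < r & forall m, (m0 <= m)%N ->
  exists rho : geodesic_ray X, [/\ rho 0 = x0,
    forall (i : nat) g, a * m%:R + b < i%:R -> near (rho (i%:R * sigma)) g ->
      side (t ^- m * g)%g &
    escapes (rho r) (A1 + kappa * r + 1)]].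
Proof.
have [a [b [a0 b0 rays]]] := transverse_ray_side.
have [L L0 HL] := word_metric_le.
have sig := ltW sigma0; have tau0' := ltW tau0.
pose M := D + L * (A * (sigma + 2 * D) + A).
have M0 : 0 <= M.
  by rewrite addr_ge0 // mulr_ge0 // addr_ge0 // mulr_ge0 // addr_ge0 // mulr_ge0.
have A10 : 0 <= A1 by rewrite addr_ge0 ?mulr_ge0 ?mdist_ge0.
(* The crossing time T is at most lam * m, while [dplus] drops by about 2 m tau up to T. *)
pose lam := sigma * (a + b + 1).
have lam0 : 0 < lam by rewrite mulr_gt0 //; lra.
pose kappa := tau / lam; have kappa0 : 0 < kappa by rewrite divr_gt0.
(* At time r the gain 2 kappa r of [dminus] then covers the errors 2 A1 + 2 M and leaves kappa r +
   2. *)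
pose r := (2 * A1 + 2 * M + 2) / kappa.
have r0 : 0 < r by rewrite divr_gt0 //; lra.
have kr : kappa * r = 2 * A1 + 2 * M + 2 by rewrite mulrC divfK // gt_eqF.
(* For m this large, T is at least r, because displacements are 2-Lipschitz. *)
exists a, b, kappa, r, (Num.truncn ((r + A1 + M) / tau)).+1; split=> // m m0m.
have m1 : 1 <= m%:R :> R by rewrite ler1n; exact: leq_ltn_trans m0m.
have mtau : r + A1 + M <= m%:R * tau.
  rewrite -ler_pdivrMr //; apply: le_trans (ltW (truncnS_gt _)) _.
  by rewrite ler_nat.
have [rho [rho0 rhoS]] := rays m; exists rho; split=> //.
have [T [c [/andP[T0 Tle] Cc rc]]] := ray_crossing L0 HL a0 b0 rho0 rhoS.
rewrite -/M in rc.
have Tlam : T <= lam * m%:R.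
  apply: le_trans Tle _; rewrite /lam -mulrA ler_wpM2l //.
  have : b <= b * m%:R by rewrite ler_peMr.
  lra.
have n2m : (2 * m <= 2 ^ (2 * m))%N by rewrite ltnW // ltn_expl.
(* Any power of 2 that is at least 2 m would do; [dplus_trans] needs 2 m <= n. *)
exists (2 * m)%N; set n := (2 ^ (2 * m))%N in n2m *.
have dT : dplus n (rho T) <= (n%:R - 2 * m%:R) * tau + A1 + 2 * M.
  apply: le_trans (displacement_triangle actP _ _ (act (t ^+ m * c)%g x0)) _.
  by rewrite lerD ?dplus_trans // ler_pM2l.
have d0 := dplus_base n; have d0' := dminus_base n.
have dd0 := dplus_dminus (2 * m) x0; rewrite -/n in dd0.
have rT : r <= T.
  have : dplus n x0 <= dplus n (rho T) + 2 * T.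
    apply: le_trans (displacement_triangle actP _ _ (rho T)) _.
    by rewrite -rho0 ray_dist0.
  lra.
have Tp : 0 < T by exact: lt_le_trans rT.
have rI : 0 <= r <= T by rewrite ltW.
have := displacement_ray (t ^+ n * gen v)%g rho rI Tp.
rewrite -/(dplus n (rho r)) -/(dplus n (rho T)) rho0 -/(dplus n x0).
have ddr := dplus_dminus (2 * m) (rho r); rewrite -/n in ddr.
have q0 : 0 <= r / T by rewrite divr_ge0 // ltW.
have q1 : r / T <= 1 by rewrite ler_pdivrMr // mul1r.
have qm : kappa * r <= r / T * m%:R * tau.
  have Tk : T * kappa <= m%:R * tau.
    by rewrite /kappa mulrA ler_pdivrMr //; have := ler_wpM2r tau0' Tlam; lra.
  by have := ler_wpM2l q0 Tk; rewrite mulrA divfK ?gt_eqF //; lra.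
have h1 : (1 - r / T) * dplus n x0 <= (1 - r / T) * (n%:R * tau + A1).
  by rewrite ler_wpM2l // subr_ge0.
have h2 : r / T * dplus n (rho T) <= r / T * ((n%:R - 2 * m%:R) * tau + A1 + 2 * M).
  by rewrite ler_wpM2l.
have h3 : r / T * M <= M by rewrite ler_piMl.
move: qm h1 h2 h3 ddr; set q := r / T; rewrite kr; lra.
Qed.

Lemma not_locally_connected : ~ locally_connected (visual_boundary x0).
Proof.
move=> lc.
have [a [b [kappa [r [m0 [kappa0 r0 rays]]]]]] := escaping_rays.
have [L L0 HL] := word_metric_le.
(* The bound of [side_crossing] for points at distance at most 1. *)
pose M := D + L * (A * (1 + 2 * D) + A).
have M0 : 0 <= M.
  by rewrite addr_ge0 // mulr_ge0 // addr_ge0 // mulr_ge0 // addr_ge0 // mulr_ge0.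
pose bpoint (c : geodesic_ray X) : visual_boundary x0 := \pi_(boundary X)%qT c.
have /choice[rho rhoP] : forall n, exists rho : geodesic_ray X, [/\ rho 0 = x0,
    forall (i : nat) g, a * (m0 + n)%:R + b < i%:R -> near (rho (i%:R * sigma)) g ->
      side (t ^- (m0 + n) * g)%g &
    escapes (rho r) (A1 + kappa * r + 1)].
  by move=> n; apply: rays; exact: leq_addr.
have rho0 n : rho n 0 = x0 by case: (rhoP n).
pose f n (l : R) := rho n (Num.max 0 l).
have [|||c [c0 clim]] := @limit_ray R X x0 proper f.
- by move=> n; rewrite /f max_l.
- move=> n l; rewrite /f -(rho0 n) ray_dist0 ?le_max ?lexx //.
  by rewrite ge_max normr_ge0 ler_norm.
- by move=> l l' l0 l'0; exists 0%N => n _; rewrite /f !max_r // ray_isometric.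
pose U (c : geodesic_ray X) := c 0 = x0 /\ escapes (c r) (A1 + kappa * r).
have Uopen : open [set bpoint c | c in U].
  apply: open_rays => [c' []//|c' [c'0 [k ck]]].
  pose d := (dminus (2 ^ k) (c' r) - (A1 + kappa * r + (2 ^ k)%:R * tau)) / 2.
  have d0 : 0 < d by rewrite divr_gt0 // subr_gt0.
  exists r, d; split=> // c'' c''0 cc; split=> //; exists k.
  have := displacement_triangle actP (gen v * t ^+ (2 ^ k))%g (c' r) (c'' r).
  by move: cc; rewrite /d /dminus; lra.
have Uc : [set bpoint c | c in U] (bpoint c).
  exists c => //; split=> //.
  have [n _ nP] := clim [:: r] (1 / 2) 0%N ltac:(lra).
  have := nP r (mem_head _ _); rewrite /f max_r ?(ltW r0) // metric_sym => /ltW.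
  by move=> /(escapes_near (let: And3 _ _ h := rhoP n in h)) [k]; exists k; lra.
have [Z [Zopen Zconn Zc ZU]] := lc _ _ (open_nbhs_nbhs (conj Uopen Uc)).
have [Ts [eps [e0 Ts0 TZ]]] := cone_base X0 c0 Zopen Zc.
have in_Z N : exists2 n, (N <= n)%N & Z (bpoint (rho n)).
  have [n Nn nP] := clim Ts eps N e0; exists n => //; apply: TZ => // l lT.
  by have := nP l lT; rewrite /f max_r //; exact: (allP Ts0).
have [n1 _ Zn1] := in_Z 0%N; have [n2 n12 Zn2] := in_Z n1.+1.
pose m1 := (m0 + n1)%N; pose m2 := (m0 + n2)%N.
(* After time S the rays of index n1 and n2 are in their own sides, and rays of U escape further
   than any point within M of t ^ m1 C can. *)
pose B := Num.max (Num.max (a * m1%:R + b) (a * m2%:R + b))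
  (Num.max (r / sigma) ((2 * m1%:R * tau + 2 * M) / kappa / sigma)).
pose i := (Num.truncn B).+1; have : B < i%:R by exact: truncnS_gt.
rewrite !gt_max => /andP[/andP[i1 i2] /andP[]].
rewrite ltr_pdivrMr // => /ltW ri; rewrite !ltr_pdivrMr // => iM.
pose S := i%:R * sigma; have S0 : 0 < S by exact: lt_le_trans ri.
(* At time S a ray of U is beyond the translates t ^ m1 * C. *)
have same_side c1 c2 g h : U c2 -> mdist (c1 S) (c2 S) < 1 ->
    near (c1 S) g -> near (c2 S) h ->
    ~ side (t ^- m1 * g)%g -> side (t ^- m1 * h)%g -> False.
  move=> [c20 Uc2] /ltW c12 c1g c2h ng sh.
  have [z Cz zS] := side_crossing L0 HL c1g c2h c12 ng sh.
  have := escapes_trans Cz (escapes_near (escapes_ray c20 r0 ri Uc2) zS).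
  rewrite -/M; lra.
pose side_set (P : W -> Prop) := [set bpoint c | c in
  [set c | U c /\ exists2 g, near (c S) g & P (t ^- m1 * g)%g]].
(* By convexity closeness at time S gives closeness at time r, so the rays near one of U are again
   in U. *)
have open_side (P : W -> Prop) :
    (forall c1 c2 g h, U c1 -> U c2 -> mdist (c1 S) (c2 S) < 1 -> near (c1 S) g ->
      near (c2 S) h -> P (t ^- m1 * g)%g -> P (t ^- m1 * h)%g) ->
    open (side_set P).
  move=> PP; apply: open_rays => [c1 [[]]//|c1 [[c10 [k ck]] [g c1g Pg]]].
  pose d := (dminus (2 ^ k) (c1 r) - (A1 + kappa * r + (2 ^ k)%:R * tau)) / 2.
  have d0 : 0 < d by rewrite divr_gt0 // subr_gt0.
  exists S, (Num.min d 1); split=> //; first by rewrite lt_min d0 ltr01.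
  move=> c2 c20; rewrite lt_min => /andP[c12d c12].
  have c12r : mdist (c1 r) (c2 r) < d.
    have c2G : geodesic c2 (c1 0) (c2 S).
      by rewrite c10 -c20; apply: ray_geodesic; exact: ltW.
    have rI : 0 <= r / S <= 1.
      by rewrite divr_ge0 ?(ltW r0) ?(ltW S0) //= ler_pdivrMr // mul1r.
    have := cat0_fan X0 (ray_geodesic c1 (ltW S0)) c2G rI.
    rewrite {2}c10 -{1}c20 !ray_dist0 ?(ltW S0) // divfK ?gt_eqF // => /le_lt_trans; apply.
    apply: le_lt_trans c12d; case/andP: rI => _ q1.
    by rewrite ler_piMl ?mdist_ge0.
  have Uc2 : U c2.
    split=> //; exists k.
    have := displacement_triangle actP (gen v * t ^+ (2 ^ k))%g (c1 r) (c2 r).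
    by move: c12r; rewrite /d /dminus; lra.
  split=> //; have [h c2h] := cocompact (c2 S); exists h => //.
  by apply: (PP c1 c2 g) => //; split=> //; exists k; move: d0; rewrite /d; lra.
have Eopen : open (side_set side).
  apply: open_side => c1 c2 g h Uc1 Uc2 c12 c1g c2h sg; apply: contrapT => nsh.
  by apply: (same_side c2 c1 h g) => //; rewrite metric_sym.
have Fopen : open (side_set (fun g => ~ side g)).
  apply: open_side => c1 c2 g h Uc1 Uc2 c12 c1g c2h nsg sh.
  exact: (same_side c1 c2 g h).
have EF (y : visual_boundary x0) : side_set side y ->
    side_set (fun g => ~ side g) y -> False.
  move=> [c1 [Uc1 [g c1g sg]] <-] [c2 [Uc2 [h c2h nsh]] /esym c12].
  have cS : c1 S = c2 S by apply: (boundary_eq X0 Uc1.1 Uc2.1 c12); exact: ltW.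
  by apply: (same_side c2 c1 h g) => //; rewrite cS mdistxx.
have Z_sides : Z `<=` side_set side `|` side_set (fun g => ~ side g).
  move=> y /ZU[c1 Uc1 <-]; have [g c1g] := cocompact (c1 S).
  by have [sg|nsg] := pselect (side (t ^- m1 * g)%g); [left|right];
    exists c1 => //; split=> //; exists g.
have Urho n : U (rho n).
  by split=> //; have [_ _ [k rk]] := rhoP n; exists k; lra.
have E1 : side_set side (bpoint (rho n1)).
  have [g rg] := cocompact (rho n1 S); exists (rho n1) => //; split=> //; exists g => //.
  by have [_ h _] := rhoP n1; exact: h rg.
have F2 : side_set (fun g => ~ side g) (bpoint (rho n2)).
  have [g rg] := cocompact (rho n2 S); exists (rho n2) => //; split=> //; exists g => //.
  have [_ h _] := rhoP n2; have := h i g i2 rg.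
  apply: (trans_side_disjoint e_sym e_irr vwK).
  by rewrite eq_sym eqn_add2l neq_ltn n12.
have ZE : Z `&` side_set side = Z.
  apply: Zconn.
  - by exists (bpoint (rho n1)).
  - by exists (side_set side).
  exists (~` side_set (fun g => ~ side g)); first exact: open_closedC.
  apply/seteqP; split=> y [Zy]; first by split=> // Fy; exact: EF Fy.
  by move=> nFy; split=> //; have [|/nFy] := Z_sides y Zy.
have : (Z `&` side_set side) (bpoint (rho n2)) by rewrite ZE.
by move=> [_ /EF]; apply.
Qed.

End Translation_Axis.
End SIL_NLC.

Theorem corollary8p5 (R : realType) (V : finType) (e : rel V)
    (V_nonempty : (0 < #|V|)%N)
    (e_sym : symmetric e) (e_irr : irreflexive e) :
  infinite_set (Out (racg e)) -> NLC R (racg e).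
Proof.
move=> Out_infinite X act X0 actP x0.
have [D [A [D0 A0 cocompact len_le proper]]] := geometric_action_proper X0 actP x0.
have [[v [w [K vwK]]]|noSIL] := pselect (exists v w K, SIL e v w K); last first.
  have [Fin finFin FinP] := finitely_many_involutions X0 actP cocompact len_le A0.
  case: Out_infinite; apply: (out_finite e_sym _ finFin FinP) => v w K vwK.
  by apply: noSIL; exists v, w, K.
have [_ _ /finset.set0Pn[u uK] _ _] := vwK.
have ax := axis X0 actP cocompact len_le proper A0.
have [qt [tau [tau0 qtP tau_le]]] := ax (trans e v w).
have [qs [sigma [sigma0 qsP _]]] := ax (transverse e v u).
have pos := axis_translation_gt0 actP len_le A0.
apply: (not_locally_connected e_sym e_irr vwK uK X0 actP D0 A0 cocompact len_le proper _ _
  qtP tau_le qsP).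
  by apply: pos qtP => //; exact: (trans_inj e_sym vwK).
by apply: pos qsP => //; exact: (transverse_inj e_sym e_irr vwK uK).
Qed.
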